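(* Let $X$, $X'$, $X^{(\infty)}$, $f$, $L_\infty(f)$, $T$, $\partial_\infty T$ and $J$ be as in the context. Then: (1) $X'\cap T=X^{(\infty)}\cap T=T-J$. (2) Let $p\in T-J$. Then $f(p)=p$ if and only if $p\in\partial_\infty T$. (3) $L_\infty(f)\cap T=\partial_\infty T$.
   Context: $X$ is the surface (boundary) of a regular octahedron, scaled to have edge length $\sqrt3$, equipped with its intrinsic metric $d_X$: $d_X(p,q)$ is the length of a shortest path on the surface joining $p$ to $q$. $A:X\to X$ is the antipodal map (restriction to the surface of the central symmetry of the octahedron). For $p\in X$, $\mathcal{F}_p\subset X$ is the set of points $q\in X$ which maximize the function $q\mapsto d_X(p,q)$. $X'\subset X$ is the set of $p$ for which $\mathcal{F}_p$ is a single point; for $p\in X'$, $F(p)$ denotes the unique element of $\mathcal{F}_p$. The map $A$ commutes with $F$, and $f=FA=AF$ on $X'$. Set $X^{(1)}=X'$ and inductively let $X^{(n+1)}$ be the set of $p\in X'$ such that $F(p)\in X^{(n)}$; set $X^{(\infty)}=\bigcap_{n\ge1}X^{(n)}$. All iterates of $F$ and of $f$ are defined on $X^{(\infty)}$. The $\omega$-limit set $L_\infty(f)$ is the set of points $p\in X$ for which there is some point $q$ (with full forward orbit defined, i.e. $q\in X^{(\infty)}$) such that $\lim_{n\to\infty}f^n(q)=p$. Identify $\mathbb{C}=\mathbb{R}^2$. One face $\Delta_0$ of $X$ is identified isometrically with the planar equilateral triangle whose vertices are the three cube roots of unity. $T\subset\Delta_0$ is the closed (solid) triangle with vertices $0$,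 $1$, $\left(\frac14,\frac{\sqrt3}4\right)$, regarded as a subset of $X$; it is a fundamental domain for the action of the isometry group of $X$. $\partial_\infty T$ is the union of the two non-horizontal (closed) sides of $T$, i.e. the sides other than the segment from $0$ to $1$. $J\subset T$ is the graph of the function $$y=\frac1{\sqrt3}\Bigl(1-x-\bigl((2+x)(5-2x)(1-4x)\bigr)^{1/3}\Bigr),\qquad x\in[r,1/4),$$ where $r\approx 0.239123$ is the root of $x^3-x^2-4x+1$ in $(0,1)$ (so the top endpoint, at $x=1/4$, is not in $J$). *)

(* Defs.v *)
From Stdlib Require Export Reals Lra Lia Psatz ClassicalEpsilon.
From Coquelicot Require Export Coquelicot.
Open Scope R_scope.

Definition plane : Type := (R * R)%type.
Definition space : Type := (R * R * R)%type.

Definition dist2 (p q : plane) : R :=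
  let '(x, y) := p in let '(x', y') := q in
  sqrt ((x - x') ^ 2 + (y - y') ^ 2).

Definition dist3 (p q : space) : R :=
  let '(x, y, z) := p in let '(x', y', z') := q in
  sqrt ((x - x') ^ 2 + (y - y') ^ 2 + (z - z') ^ 2).

(** The octahedron has vertices at distance [circumradius] from the origin on
    the coordinate axes; its edges then have length [sqrt 3] (see [edge_length]). *)
Definition circumradius : R := sqrt (3 / 2).

Definition X (p : space) : Prop :=
  let '(x, y, z) := p in Rabs x + Rabs y + Rabs z = circumradius.

Definition path_in_X (g : R -> space) (p q : space) : Prop :=
  continuous_on (fun t => 0 <= t <= 1) g /\
  (forall t, 0 <= t <= 1 -> X (g t)) /\
  g 0 = p /\ g 1 = q.

Definition subdivision (n : nat) (s : nat -> R) : Prop :=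
  s O = 0 /\ s (S n) = 1 /\ forall i, (i <= n)%nat -> s i <= s (S i).

Definition inscribed_length (g : R -> space) (n : nat) (s : nat -> R) : R :=
  sum_f_R0 (fun i => dist3 (g (s i)) (g (s (S i)))) n.

Definition has_length (g : R -> space) (l : R) : Prop :=
  is_lub (fun m => exists n s, subdivision n s /\ m = inscribed_length g n s) l.

Definition dX (p q : space) : R :=
  real (Glb_Rbar (fun l => exists g, path_in_X g p q /\ has_length g l)).

Definition A (p : space) : space := let '(x, y, z) := p in (- x, - y, - z).

Definition farthest (p q : space) : Prop :=
  X q /\ forall q', X q' -> dX p q' <= dX p q.

Definition X' (p : space) : Prop := X p /\ exists! q, farthest p q.

(** [F p] is meaningful only when [X' p] holds. *)
Definition F (p : space) : space :=
  epsilon (inhabits ((0, 0, 0) : space)) (farthest p).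

Definition f (p : space) : space := F (A p).

(** [X_iter n] is the set on which the first [n+1] iterates of [F] are defined,
    i.e. the indexing is shifted by one: [X_iter 0] is [X']. *)
Fixpoint X_iter (n : nat) (p : space) : Prop :=
  match n with
  | O => X' p
  | S m => X' p /\ X_iter m (F p)
  end.

Definition X_infty (p : space) : Prop := forall n, X_iter n p.

Definition L_infty (p : space) : Prop :=
  X p /\ exists q, X_infty q /\
    filterlim (fun n : nat => Nat.iter n f q) eventually (locally p).

(** The point of the face spanned by the positive half-axes whose barycentric
    coordinates are those of [w] with respect to the three cube roots of unity. *)
Definition emb (w : plane) : space :=
  let '(x, y) := w in
  (circumradius * ((1 + 2 * x) / 3),
   circumradius * ((1 - x + sqrt 3 * y) / 3),
   circumradius * ((1 - x - sqrt 3 * y) / 3)).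

Definition segment (P Q : plane) (w : plane) : Prop :=
  exists a b, 0 <= a /\ 0 <= b /\ a + b = 1 /\
    w = (a * fst P + b * fst Q, a * snd P + b * snd Q).

Definition solid_triangle (P Q S : plane) (w : plane) : Prop :=
  exists a b c, 0 <= a /\ 0 <= b /\ 0 <= c /\ a + b + c = 1 /\
    w = (a * fst P + b * fst Q + c * fst S, a * snd P + b * snd Q + c * snd S).

Definition image (D : plane -> Prop) (p : space) : Prop :=
  exists w, D w /\ p = emb w.

Definition apex : plane := (1 / 4, sqrt 3 / 4).

Definition T : space -> Prop := image (solid_triangle (0, 0) (1, 0) apex).

Definition dT_infty : space -> Prop :=
  image (fun w => segment (0, 0) apex w \/ segment (1, 0) apex w).

Lemma r_exists : {r : R | 0 < r < 1 /\ r ^ 3 - r ^ 2 - 4 * r + 1 = 0}.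
Proof.
destruct (IVT (fun x => - (x ^ 3 - x ^ 2 - 4 * x + 1)) 0 1) as [r [[Hr0 Hr1] Hr]];
  try lra; [reg |].
exists r; split; [| lra].
split.
- destruct Hr0 as [Hr0 | Hr0]; [exact Hr0 | subst r; lra].
- destruct Hr1 as [Hr1 | Hr1]; [exact Hr1 | subst r; lra].
Qed.

Lemma r_unique (r s : R) :
  0 < r < 1 -> r ^ 3 - r ^ 2 - 4 * r + 1 = 0 ->
  0 < s < 1 -> s ^ 3 - s ^ 2 - 4 * s + 1 = 0 -> r = s.
Proof.
intros Hr Er Hs Es.
assert (H : (r - s) * (r ^ 2 + r * s + s ^ 2 - (r + s) - 4) = 0) by lra.
apply Rmult_integral in H as [H | H]; [lra | nra].
Qed.

Definition r : R := proj1_sig r_exists.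

(** On [r <= x < 1/4] the argument of [Rpower] is positive, so that
    [Rpower _ (1 / 3)] is the cube root. *)
Definition J_fun (x : R) : R :=
  1 / sqrt 3 * (1 - x - Rpower ((2 + x) * (5 - 2 * x) * (1 - 4 * x)) (1 / 3)).

Definition J : space -> Prop :=
  image (fun w => r <= fst w < 1 / 4 /\ snd w = J_fun (fst w)).

Lemma sqrt3_sqr : sqrt 3 * sqrt 3 = 3.
Proof. apply sqrt_sqrt; lra. Qed.

Lemma circumradius_sqr : circumradius * circumradius = 3 / 2.
Proof. apply sqrt_sqrt; lra. Qed.

Lemma edge_length :
  dist3 (circumradius, 0, 0) (0, circumradius, 0) = sqrt 3.
Proof.
unfold dist3; f_equal; pose proof circumradius_sqr; lra.
Qed.

Lemma emb_isometry (v w : plane) : dist3 (emb v) (emb w) = dist2 v w.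
Proof.
destruct v as [x y], w as [x' y']; unfold dist3, dist2, emb; f_equal.
transitivity (circumradius * circumradius *
  (6 * (x - x') ^ 2 + 2 * (sqrt 3 * sqrt 3) * (y - y') ^ 2) / 9); [field |].
rewrite circumradius_sqr, sqrt3_sqr; field.
Qed.

Lemma emb_vertices :
  emb (1, 0) = (circumradius, 0, 0) /\
  emb (- 1 / 2, sqrt 3 / 2) = (0, circumradius, 0) /\
  emb (- 1 / 2, - sqrt 3 / 2) = (0, 0, circumradius).
Proof.
pose proof sqrt3_sqr as H.
unfold emb; repeat split; repeat apply f_equal2; try (f_equal; field).
all: match goal with |- _ * ?e = ?c =>
  (replace e with 0 by lra; ring) || (replace e with 1 by lra; ring) end.
Qed.

(* Main.v *)
Require Import Defs.
From Stdlib Require Import Compare_dec.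

(* Unfolding the octahedron along the six sequences of edges leading from the face of [p]
   to the antipodal face gives six planar images of [p], and the distance from [p] to a
   point of the antipodal face is the least distance to these images: each straight
   segment to an image stays in its strip of faces, and conversely the minimum over the
   images is well defined on edges and 1-Lipschitz on faces.  In the coordinates [x] and
   [Y = sqrt 3 * y], two of the images are mirror images in the horizontal line through
   [p], so a farthest point lies at the height of [p], at one of two Voronoi vertices
   [left_vertex x Y <= x <= right_vertex x Y]; these coincide exactly on the two
   non-horizontal sides of [T].  Which vertex is farther is decided by the sign of
   [balance], whose zero set in [T] is [J] with the apex added.  Since [balance] increases with [x], [f]
   moves each side of [J] horizontally away from [J]. *)

(** [dX] is an infimum over arbitrary rectifiable curves, so a lower bound cannot come from cutting
    a curve at its finitely many crossings. A function on the whole surface serves instead: it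
    vanishes at [p], grows at most as fast as length, and is the least image distance on the
    antipodal face. Upper bounds come from explicit segments and suffice to exclude points; the
    lower bound is applied only at the two Voronoi vertices. The two mirror images are centred at
    [(1/2 - x, Y + 9/2)] and [(1/2 - x, Y - 9/2)], so along the line [T = Y] their common squared
    distance is a convex parabola in [u], largest at an end of the interval between the vertices.
    Its two end values differ by the gap between the vertices times a positive multiple of
    [balance]. For the limit set no convergence of orbits is studied: the points of the two sides
    are fixed, and being a farthest point of one's own antipode is a closed condition, met in [T]
    only on these sides. *)

Lemma dist3_nonneg p q : 0 <= dist3 p q.
Proof. destruct p as [[? ?] ?], q as [[? ?] ?]; apply sqrt_pos. Qed.

Lemma dist3_refl p : dist3 p p = 0.
Proof.
destruct p as [[x y] z]; unfold dist3.
replace (_ + _) with 0 by ring; apply sqrt_0.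
Qed.

Lemma dist3_sym p q : dist3 p q = dist3 q p.
Proof.
destruct p as [[? ?] ?], q as [[? ?] ?]; unfold dist3; f_equal; ring.
Qed.

(** * Euclidean norm and continuity of curves in space *)

Definition norm3 (x y z : R) : R := sqrt (x ^ 2 + y ^ 2 + z ^ 2).

Lemma norm3_sqr x y z : norm3 x y z ^ 2 = x ^ 2 + y ^ 2 + z ^ 2.
Proof. unfold norm3; rewrite <- Rsqr_pow2; apply Rsqr_sqrt; nra. Qed.

Lemma norm3_nonneg x y z : 0 <= norm3 x y z.
Proof. apply sqrt_pos. Qed.

Lemma norm3_triangle x y z x' y' z' :
  norm3 (x + x') (y + y') (z + z') <= norm3 x y z + norm3 x' y' z'.
Proof.
pose proof (norm3_sqr x y z) as E; pose proof (norm3_sqr x' y' z') as E'.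
pose proof (norm3_sqr (x + x') (y + y') (z + z')) as E''.
pose proof (norm3_nonneg x y z) as P; pose proof (norm3_nonneg x' y' z') as P'.
set (n := norm3 x y z) in *; set (n' := norm3 x' y' z') in *.
set (n'' := norm3 (x + x') (y + y') (z + z')) in *.
assert (C : x * x' + y * y' + z * z' <= n * n').
{ apply Rsqr_incr_0_var; [unfold Rsqr | nra].
  replace (n * n' * (n * n')) with (n ^ 2 * n' ^ 2) by ring; rewrite E, E'.
  pose proof (pow2_ge_0 (x * y' - y * x')); pose proof (pow2_ge_0 (x * z' - z * x')).
  pose proof (pow2_ge_0 (y * z' - z * y')); lra. }
apply Rsqr_incr_0_var; unfold Rsqr; nra.
Qed.

Lemma dist3_norm3 x y z x' y' z' :
  dist3 (x, y, z) (x', y', z') = norm3 (x - x') (y - y') (z - z').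
Proof. reflexivity. Qed.

Lemma norm3_coord x y z :
  Rabs x <= norm3 x y z /\ Rabs y <= norm3 x y z /\ Rabs z <= norm3 x y z.
Proof.
unfold norm3; repeat split; rewrite <- sqrt_Rsqr_abs; apply sqrt_le_1_alt; unfold Rsqr; nra.
Qed.

Lemma norm3_le_sum x y z : norm3 x y z <= Rabs x + Rabs y + Rabs z.
Proof.
pose proof (Rabs_pos x); pose proof (Rabs_pos y); pose proof (Rabs_pos z).
apply Rsqr_incr_0_var; [| lra].
unfold Rsqr; pose proof (norm3_sqr x y z) as E.
rewrite <- (pow2_abs x), <- (pow2_abs y), <- (pow2_abs z) in E; nra.
Qed.

Lemma ball_dist3 (p q : space) (eps : posreal) : dist3 p q < eps -> ball p eps q.
Proof.
destruct p as [[x y] z], q as [[x' y'] z']; rewrite dist3_norm3; intro H.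
destruct (norm3_coord (x - x') (y - y') (z - z')) as [Hx [Hy Hz]].
split; [split |]; [change (Rabs (x' - x) < eps) | change (Rabs (y' - y) < eps) |
  change (Rabs (z' - z) < eps)]; rewrite Rabs_minus_sym; lra.
Qed.

Lemma dist3_ball (p q : space) (eps : posreal) : ball p eps q -> dist3 p q < 3 * eps.
Proof.
destruct p as [[x y] z], q as [[x' y'] z']; rewrite dist3_norm3.
intros [[Hx Hy] Hz].
change (Rabs (x' - x) < eps) in Hx; change (Rabs (y' - y) < eps) in Hy.
change (Rabs (z' - z) < eps) in Hz.
pose proof (norm3_le_sum (x - x') (y - y') (z - z')).
rewrite (Rabs_minus_sym x), (Rabs_minus_sym y), (Rabs_minus_sym z) in H; lra.
Qed.

Lemma continuous_on_dist3 (g : R -> space) :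
  continuous_on (fun t => 0 <= t <= 1) g <->
  forall t, 0 <= t <= 1 -> forall eps, 0 < eps -> exists delta, 0 < delta /\
    forall s, 0 <= s <= 1 -> Rabs (s - t) < delta -> dist3 (g t) (g s) < eps.
Proof.
split.
- intros H t Ht eps Heps.
  assert (H3 : 0 < eps / 3) by lra.
  specialize (H t Ht (ball (g t) (mkposreal _ H3)) (locally_ball _ _)).
  destruct H as [delta H]; exists delta; split; [apply cond_pos |].
  intros s Hs Hst.
  replace eps with (3 * mkposreal _ H3) by (simpl; field).
  apply dist3_ball, H; [exact Hst | exact Hs].
- intros H t Ht P [eps HP].
  destruct (H t Ht eps (cond_pos eps)) as [delta [Hd Hs]].
  exists (mkposreal _ Hd); intros s Hst Hs01.
  apply HP, ball_dist3, Hs; [exact Hs01 | exact Hst].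
Qed.

(** A zero coordinate is compatible with either sign, so a point of an edge shares a closed face
    with the points on both sides of it. *)
Definition same_face (p q : space) : Prop :=
  let '(x, y, z) := p in let '(x', y', z') := q in
  0 <= x * x' /\ 0 <= y * y' /\ 0 <= z * z'.

(** * Rectifiable paths and the intrinsic metric *)

(* A rectifiable path is recorded together with a potential [L], which plays the
   role of arc length. *)
Definition reach (p q : space) (l : R) : Prop :=
  exists (g : R -> space) (L : R -> R), path_in_X g p q /\
    (forall s t, 0 <= s -> s <= t -> t <= 1 -> dist3 (g s) (g t) <= L t - L s) /\
    L 1 - L 0 <= l.

Lemma subdivision_bounds n s : subdivision n s ->
  forall i, (i <= S n)%nat -> 0 <= s i <= 1.
Proof.
intros [H0 [H1 Hm]] i Hi; split.
- induction i as [| i IH]; [lra |].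
  apply Rle_trans with (s i); [apply IH | apply Hm]; lia.
- rewrite <- H1.
  assert (K : forall k, (k <= S n)%nat -> s (S n - k)%nat <= s (S n)).
  { induction k as [| k IH]; intro Hk.
    - replace (S n - 0)%nat with (S n) by lia; lra.
    - apply Rle_trans with (s (S n - k)%nat); [| apply IH; lia].
      replace (S n - k)%nat with (S (S n - S k)) by lia; apply Hm; lia. }
  replace i with (S n - (S n - i))%nat by lia; apply K; lia.
Qed.

Lemma inscribed_le_potential (g : R -> space) (L : R -> R) n s :
  (forall s t, 0 <= s -> s <= t -> t <= 1 -> dist3 (g s) (g t) <= L t - L s) ->
  subdivision n s -> inscribed_length g n s <= L 1 - L 0.
Proof.
intros HL Hs; pose proof (subdivision_bounds _ _ Hs) as Hb.
destruct Hs as [H0 [H1 Hm]]; rewrite <- H0, <- H1; clear H0 H1.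
assert (K : forall m, (m <= n)%nat ->
  sum_f_R0 (fun i => dist3 (g (s i)) (g (s (S i)))) m <= L (s (S m)) - L (s O)).
{ induction m as [| m IH]; intro Hmn; simpl.
  - apply HL; [apply Hb; lia | apply Hm; lia | apply Hb; lia].
  - assert (dist3 (g (s (S m))) (g (s (S (S m)))) <= L (s (S (S m))) - L (s (S m)))
      by (apply HL; [apply Hb; lia | apply Hm; lia | apply Hb; lia]).
    specialize (IH ltac:(lia)); lra. }
apply K; lia.
Qed.

Lemma reach_length p q l : reach p q l ->
  exists g l', path_in_X g p q /\ has_length g l' /\ l' <= l.
Proof.
intros [g [L [Hg [HL Hl]]]].
assert (Hub : forall m, (exists n s, subdivision n s /\ m = inscribed_length g n s) ->
  m <= l).
{ intros m [n [s [Hs ->]]].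
  pose proof (inscribed_le_potential g L n s HL Hs); lra. }
destruct (completeness (fun m => exists n s, subdivision n s /\ m = inscribed_length g n s))
  as [l' Hl'].
- exists l; exact Hub.
- exists (inscribed_length g 0 (fun i => match i with O => 0 | _ => 1 end)), O,
    (fun i => match i with O => 0 | _ => 1 end).
  split; [| reflexivity]; repeat split.
  intros i Hi; replace i with O by lia; lra.
- exists g, l'; split; [exact Hg | split; [exact Hl' |]].
  apply Hl'; exact Hub.
Qed.

Definition chain (t : R) (n : nat) (s : nat -> R) : Prop :=
  s O = 0 /\ s (S n) = t /\ forall i, (i <= n)%nat -> s i <= s (S i).

Lemma chain_extend (g : R -> space) n s t t' : t <= t' -> chain t n s ->
  exists s', chain t' (S n) s' /\
    inscribed_length g (S n) s' = inscribed_length g n s + dist3 (g t) (g t').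
Proof.
intros Ht [H0 [H1 Hm]].
exists (fun i => if le_dec i (S n) then s i else t'); split; [split; [| split] |].
- destruct (le_dec 0 (S n)); [exact H0 | lia].
- destruct (le_dec (S (S n)) (S n)); [lia | reflexivity].
- intros i Hi; destruct (le_dec i (S n)), (le_dec (S i) (S n)); try lia.
  + apply Hm; lia.
  + replace i with (S n) by lia; rewrite H1; exact Ht.
- unfold inscribed_length; simpl; f_equal.
  + apply sum_eq; intros i Hi.
    destruct (le_dec i (S n)), (le_dec (S i) (S n)); try lia; reflexivity.
  + destruct (le_dec (S n) (S n)), (le_dec (S (S n)) (S n)); try lia.
    rewrite H1; reflexivity.
Qed.

(** The potential at [t] is the length of [g] on [[0, t]], the supremum over chains ending at [t].
    It is finite because one more step from [t] to 1 turns a chain into a subdivision. *)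
Lemma length_reach g p q l : path_in_X g p q -> has_length g l -> reach p q l.
Proof.
intros Hg [Hub _].
assert (Hb : forall t, 0 <= t <= 1 -> forall n s, chain t n s -> inscribed_length g n s <= l).
{ intros t Ht n s Hc.
  destruct (chain_extend g n s t 1 ltac:(lra) Hc) as [s' [Hc' E]].
  assert (inscribed_length g (S n) s' <= l) by (apply Hub; exists (S n), s'; split; auto).
  pose proof (dist3_nonneg (g t) (g 1)); lra. }
assert (HL : forall t, {m | 0 <= t <= 1 ->
  is_lub (fun m => exists n s, chain t n s /\ m = inscribed_length g n s) m}).
{ intro t; destruct (Rle_dec 0 t) as [H0 | H0];
    [destruct (Rle_dec t 1) as [H1 | H1] |]; try (exists 0; lra).
  destruct (completeness (fun m => exists n s, chain t n s /\ m = inscribed_length g n s))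
    as [m Hm].
  - exists l; intros m [n [s [Hc ->]]]; apply (Hb t); auto.
  - exists (inscribed_length g 0 (fun i => match i with O => 0 | _ => t end)), O,
      (fun i => match i with O => 0 | _ => t end).
    split; [| reflexivity]; repeat split.
    intros i Hi; replace i with O by lia; lra.
  - exists m; auto. }
exists g, (fun t => proj1_sig (HL t)); split; [exact Hg |]; split.
- intros s t Hs Hst Ht.
  destruct (HL s) as [ms Hms], (HL t) as [mt Hmt]; simpl.
  specialize (Hms ltac:(lra)); specialize (Hmt ltac:(lra)).
  enough (ms <= mt - dist3 (g s) (g t)) by lra.
  apply Hms; intros m [n [s' [Hc ->]]].
  destruct (chain_extend g n s' s t Hst Hc) as [s'' [Hc' E]].
  assert (inscribed_length g (S n) s'' <= mt) by (apply Hmt; eauto); lra.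
- destruct (HL 0) as [m0 Hm0], (HL 1) as [m1 Hm1]; simpl.
  specialize (Hm0 ltac:(lra)); specialize (Hm1 ltac:(lra)).
  assert (0 <= m0).
  { apply Hm0; exists O, (fun _ => 0); split; [repeat split; intros; lra |].
    unfold inscribed_length; simpl; rewrite dist3_refl; reflexivity. }
  assert (m1 <= l).
  { apply Hm1; intros m [n [s [Hc ->]]]; apply (Hb 1); [lra | exact Hc]. }
  lra.
Qed.

Lemma reach_nonneg p q l : reach p q l -> 0 <= l.
Proof.
intros [g [L [_ [HL Hl]]]].
pose proof (HL 0 1 ltac:(lra) ltac:(lra) ltac:(lra)).
pose proof (dist3_nonneg (g 0) (g 1)); lra.
Qed.

(** [real] sends infinite values to 0, so finiteness has to be established: one path of finite
    length excludes plus infinity, and lengths being nonnegative excludes minus infinity. *)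
Lemma dX_is_glb p q l0 : reach p q l0 ->
  (forall l, reach p q l -> dX p q <= l) /\
  (forall m, (forall l, reach p q l -> m <= l) -> m <= dX p q).
Proof.
intros H0; unfold dX.
set (E := fun l => exists g, path_in_X g p q /\ has_length g l).
destruct (Glb_Rbar_correct E) as [Hlb Hglb].
assert (HE : forall l, reach p q l -> exists l', E l' /\ l' <= l).
{ intros l Hl; destruct (reach_length p q l Hl) as [g [l' [Hg [Hl' Hll]]]].
  exists l'; split; [exists g; auto | exact Hll]. }
assert (HE' : forall l, E l -> reach p q l).
{ intros l [g [Hg Hl]]; exact (length_reach g p q l Hg Hl). }
assert (F0 : Rbar_le 0 (Glb_Rbar E)).
{ apply Hglb; intros l Hl; apply (reach_nonneg p q), HE', Hl. }
destruct (HE l0 H0) as [l1 [Hl1 _]].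
pose proof (Hlb l1 Hl1) as F1.
destruct (Glb_Rbar E) as [v | |]; simpl in *; try contradiction.
split.
- intros l Hl; destruct (HE l Hl) as [l' [Hl' Hle]].
  specialize (Hlb l' Hl'); simpl in Hlb; lra.
- intros m Hm; apply (Hglb (Finite m)); intros l Hl; apply Hm, HE', Hl.
Qed.

Lemma dX_le p q l : reach p q l -> dX p q <= l.
Proof. intro H; apply (dX_is_glb p q l H), H. Qed.

(** * Concatenation, reversal and straight segments *)

Lemma clamp_lipschitz s t :
  Rabs (Rmin 1 (2 * s) - Rmin 1 (2 * t)) <= 2 * Rabs (s - t) /\
  Rabs (Rmax 0 (2 * s - 1) - Rmax 0 (2 * t - 1)) <= 2 * Rabs (s - t).
Proof.
unfold Rmin, Rmax; repeat destruct Rle_dec; unfold Rabs; repeat destruct Rcase_abs; lra.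
Qed.

(** With [m] the end of [g] and the start of [h], one of the two clamped curves always rests at [m],
    and subtracting [m] leaves the other. A single formula spares a case distinction at [t = 1/2] in
    the continuity proof. *)
Definition glue (g h : R -> space) (m : space) (t : R) : space :=
  let '(x, y, z) := g (Rmin 1 (2 * t)) in
  let '(x', y', z') := h (Rmax 0 (2 * t - 1)) in
  let '(a, b, c) := m in (x + x' - a, y + y' - b, z + z' - c).

Lemma glue_dist3 g h m s t :
  dist3 (glue g h m s) (glue g h m t) <=
  dist3 (g (Rmin 1 (2 * s))) (g (Rmin 1 (2 * t))) +
  dist3 (h (Rmax 0 (2 * s - 1))) (h (Rmax 0 (2 * t - 1))).
Proof.
unfold glue.
destruct (g (Rmin 1 (2 * s))) as [[x1 y1] z1], (g (Rmin 1 (2 * t))) as [[x2 y2] z2].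
destruct (h (Rmax 0 (2 * s - 1))) as [[x3 y3] z3], (h (Rmax 0 (2 * t - 1))) as [[x4 y4] z4].
destruct m as [[a b] c]; rewrite !dist3_norm3.
replace (x1 + x3 - a - (x2 + x4 - a)) with ((x1 - x2) + (x3 - x4)) by ring.
replace (y1 + y3 - b - (y2 + y4 - b)) with ((y1 - y2) + (y3 - y4)) by ring.
replace (z1 + z3 - c - (z2 + z4 - c)) with ((z1 - z2) + (z3 - z4)) by ring.
apply norm3_triangle.
Qed.

Lemma glue_left g h m t : h 0 = m -> t <= 1 / 2 -> glue g h m t = g (2 * t).
Proof.
intros Hm Ht; unfold glue; rewrite Rmin_right, Rmax_left, Hm by lra.
destruct (g (2 * t)) as [[x y] z], m as [[a b] c]; f_equal; [f_equal |]; ring.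
Qed.

Lemma glue_right g h m t : g 1 = m -> 1 / 2 <= t -> glue g h m t = h (2 * t - 1).
Proof.
intros Hm Ht; unfold glue; rewrite Rmin_left, Rmax_right, Hm by lra.
destruct (h (2 * t - 1)) as [[x y] z], m as [[a b] c]; f_equal; [f_equal |]; ring.
Qed.

Lemma clamp_range t : 0 <= t <= 1 ->
  0 <= Rmin 1 (2 * t) <= 1 /\ 0 <= Rmax 0 (2 * t - 1) <= 1.
Proof.
intro H; unfold Rmin, Rmax; repeat destruct Rle_dec; lra.
Qed.

Lemma clamp_monotone s t : s <= t ->
  Rmin 1 (2 * s) <= Rmin 1 (2 * t) /\ Rmax 0 (2 * s - 1) <= Rmax 0 (2 * t - 1).
Proof.
intro H; unfold Rmin, Rmax; repeat destruct Rle_dec; lra.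
Qed.

Lemma reach_trans p q s l l' : reach p q l -> reach q s l' -> reach p s (l + l').
Proof.
intros [g [L [[Cg [Xg [g0 g1]]] [HL Hl]]]] [h [M [[Ch [Xh [h0 h1]]] [HM Hl']]]].
exists (glue g h q), (fun t => L (Rmin 1 (2 * t)) + M (Rmax 0 (2 * t - 1))).
split; [split; [| split; [| split]] | split].
- rewrite continuous_on_dist3 in Cg, Ch; rewrite continuous_on_dist3.
  intros t Ht eps Heps.
  destruct (clamp_range t Ht) as [R1 R2].
  destruct (Cg _ R1 (eps / 2) ltac:(lra)) as [d1 [Hd1 K1]].
  destruct (Ch _ R2 (eps / 2) ltac:(lra)) as [d2 [Hd2 K2]].
  (* The clamps at most double differences of the parameter. *)
  exists (Rmin d1 d2 / 2); split.
  { assert (0 < Rmin d1 d2) by (apply Rmin_glb_lt; auto); lra. }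
  intros u Hu Hut.
  destruct (clamp_range u Hu) as [S1 S2], (clamp_lipschitz u t) as [E1 E2].
  pose proof (Rmin_l d1 d2); pose proof (Rmin_r d1 d2).
  specialize (K1 _ S1 ltac:(lra)); specialize (K2 _ S2 ltac:(lra)).
  pose proof (glue_dist3 g h q t u); lra.
- intros t Ht; destruct (Rle_dec t (1 / 2)).
  + rewrite glue_left by auto; apply Xg; lra.
  + rewrite glue_right by (auto; lra); apply Xh; lra.
- rewrite glue_left by (auto; lra); rewrite Rmult_0_r; exact g0.
- rewrite glue_right by (auto; lra); replace (2 * 1 - 1) with 1 by ring; exact h1.
- intros u t Hu Hut Ht.
  destruct (clamp_range u ltac:(lra)) as [S1 S2], (clamp_range t ltac:(lra)) as [R1 R2].
  destruct (clamp_monotone u t Hut) as [E1 E2].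
  pose proof (glue_dist3 g h q u t).
  pose proof (HL _ _ (proj1 S1) E1 (proj2 R1)).
  pose proof (HM _ _ (proj1 S2) E2 (proj2 R2)); lra.
- rewrite (Rmin_left 1), (Rmin_right 1), (Rmax_right 0), (Rmax_left 0) by lra.
  replace (2 * 1 - 1) with 1 by ring; rewrite Rmult_0_r; lra.
Qed.

Lemma reach_sym p q l : reach p q l -> reach q p l.
Proof.
intros [g [L [[Cg [Xg [g0 g1]]] [HL Hl]]]].
exists (fun t => g (1 - t)), (fun t => - L (1 - t)); split; [split; [| split; [| split]] | split].
- rewrite continuous_on_dist3 in Cg; rewrite continuous_on_dist3.
  intros t Ht eps Heps.
  destruct (Cg (1 - t) ltac:(lra) eps Heps) as [d [Hd K]].
  exists d; split; [exact Hd |]; intros s Hs Hst; apply K; [lra |].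
  replace (1 - s - (1 - t)) with (- (s - t)) by ring; rewrite Rabs_Ropp; exact Hst.
- intros t Ht; apply Xg; lra.
- rewrite <- g1; f_equal; ring.
- rewrite <- g0; f_equal; ring.
- intros s t Hs Hst Ht; rewrite dist3_sym.
  pose proof (HL (1 - t) (1 - s) ltac:(lra) ltac:(lra) ltac:(lra)); lra.
- replace (1 - 1) with 0 by ring; replace (1 - 0) with 1 by ring; lra.
Qed.

Lemma reach_map (h : space -> space) :
  (forall q, X q -> X (h q)) -> (forall q q', dist3 (h q) (h q') = dist3 q q') ->
  forall p q l, reach p q l -> reach (h p) (h q) l.
Proof.
intros HX Hh p q l [g [L [[Cg [Xg [g0 g1]]] [HL Hl]]]].
exists (fun t => h (g t)), L; split; [split; [| split; [| split]] | split].
- rewrite continuous_on_dist3 in Cg; rewrite continuous_on_dist3.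
  intros t Ht eps Heps.
  destruct (Cg t Ht eps Heps) as [d [Hd K]].
  exists d; split; [exact Hd |]; intros s Hs Hst; rewrite Hh; auto.
- auto.
- rewrite g0; reflexivity.
- rewrite g1; reflexivity.
- intros s t Hs Hst Ht; rewrite Hh; auto.
- exact Hl.
Qed.

Lemma Rabs_convex a b t : 0 <= a * b -> 0 <= t <= 1 ->
  Rabs (a + t * (b - a)) = (1 - t) * Rabs a + t * Rabs b.
Proof.
intros H Ht; destruct (Rle_dec 0 a) as [Ha | Ha], (Rle_dec 0 b) as [Hb | Hb].
- rewrite !Rabs_pos_eq; nra.
- assert (a = 0) by nra; subst a; rewrite Rabs_R0, (Rabs_left1 b), Rabs_left1; nra.
- assert (b = 0) by nra; subst b; rewrite Rabs_R0, (Rabs_left1 a), Rabs_left1; nra.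
- rewrite !Rabs_left1; nra.
Qed.

Lemma norm3_scale t x y z : norm3 (t * x) (t * y) (t * z) = Rabs t * norm3 x y z.
Proof.
unfold norm3; rewrite <- sqrt_Rsqr_abs, <- sqrt_mult_alt; [f_equal; unfold Rsqr; ring |].
apply Rle_0_sqr.
Qed.

(** No coordinate changes sign along the segment, so [Rabs] is affine on each coordinate and the
    segment stays in [X]. *)
Lemma reach_segment p q : X p -> X q -> same_face p q -> reach p q (dist3 p q).
Proof.
destruct p as [[x y] z], q as [[x' y'] z']; unfold X; intros Hp Hq [Hx [Hy Hz]].
set (d := dist3 (x, y, z) (x', y', z')).
set (g t := (x + t * (x' - x), y + t * (y' - y), z + t * (z' - z)) : space).
assert (Hd : forall s t, dist3 (g s) (g t) = Rabs (t - s) * d).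
{ intros s t; unfold g, d; rewrite !dist3_norm3, <- norm3_scale.
  replace (x + s * (x' - x) - (x + t * (x' - x))) with ((t - s) * (x - x')) by ring.
  replace (y + s * (y' - y) - (y + t * (y' - y))) with ((t - s) * (y - y')) by ring.
  replace (z + s * (z' - z) - (z + t * (z' - z))) with ((t - s) * (z - z')) by ring.
  reflexivity. }
assert (Hd0 : 0 <= d) by apply dist3_nonneg.
exists g, (fun t => t * d); split; [split; [| split; [| split]] | split].
- rewrite continuous_on_dist3; intros t Ht eps Heps.
  exists (eps / (d + 1)); split; [apply Rdiv_lt_0_compat; lra |].
  intros s Hs Hst; rewrite Hd.
  apply Rle_lt_trans with (Rabs (s - t) * (d + 1)).
  + pose proof (Rabs_pos (s - t)); nra.
  + apply (Rmult_lt_compat_r (d + 1)) in Hst; [| lra].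
    replace (eps / (d + 1) * (d + 1)) with eps in Hst by (field; lra); exact Hst.
- intros t Ht; unfold g, X; rewrite !Rabs_convex by auto.
  transitivity ((1 - t) * (Rabs x + Rabs y + Rabs z) + t * (Rabs x' + Rabs y' + Rabs z'));
    [ring |].
  rewrite Hp, Hq; ring.
- unfold g; f_equal; [f_equal |]; ring.
- unfold g; f_equal; [f_equal |]; ring.
- intros s t Hs Hst Ht; rewrite Hd, Rabs_pos_eq by lra; lra.
- lra.
Qed.

(** * Lower bounds for the length of paths *)

(** Let [m] be the supremum of the times at which [psi] is at most [psi 0]. Comparison to the left
    of [m] shows that [m] is such a time; comparison to the right yields a later one unless
    [m = 1]. *)
Lemma locally_nonincreasing (psi : R -> R) :
  (forall t, 0 <= t <= 1 -> exists d, 0 < d /\ forall s, 0 <= s <= 1 ->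
     Rabs (s - t) < d -> (s <= t -> psi t <= psi s) /\ (t <= s -> psi s <= psi t)) ->
  psi 1 <= psi 0.
Proof.
intro H.
set (S t := 0 <= t <= 1 /\ psi t <= psi 0).
destruct (completeness S) as [m [Hub Hlub]].
- exists 1; intros t [Ht _]; lra.
- exists 0; split; lra.
- assert (Hm : 0 <= m <= 1).
  { split; [apply Hub; split; lra | apply Hlub; intros t [Ht _]; lra]. }
  destruct (H m Hm) as [d [Hd K]].
  assert (HS : psi m <= psi 0).
  { destruct (Classical_Prop.classic (exists s, S s /\ m - d < s)) as [[s [[Hs Es] Hsm]] | N].
    - assert (s <= m) by (apply Hub; split; auto).
      destruct (K s Hs) as [K1 _]; [rewrite Rabs_left1; lra |].
      specialize (K1 H0); lra.
    - exfalso; assert (m <= m - d); [| lra].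
      apply Hlub; intros s Hs; apply Rnot_lt_le; intro; apply N; eauto. }
  destruct (Rle_lt_or_eq_dec m 1 (proj2 Hm)) as [Hlt | ->]; [| exact HS].
  exfalso; set (t := Rmin 1 (m + d / 2)).
  assert (Ht : m < t <= 1 /\ t <= m + d / 2).
  { unfold t, Rmin; destruct Rle_dec; lra. }
  destruct (K t ltac:(lra)) as [_ K2]; [rewrite Rabs_pos_eq; lra |].
  specialize (K2 ltac:(lra)).
  assert (t <= m) by (apply Hub; split; lra); lra.
Qed.

Lemma sign_stable a : exists d, 0 < d /\ forall b, Rabs (b - a) < d -> 0 <= a * b.
Proof.
destruct (Req_dec a 0) as [-> | Ha].
- exists 1; split; [lra | intros; lra].
- exists (Rabs a); split; [apply Rabs_pos_lt; exact Ha |].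
  intros b Hb; unfold Rabs in Hb; repeat destruct Rcase_abs; nra.
Qed.

Lemma same_face_near p : exists d, 0 < d /\ forall q, dist3 p q < d -> same_face p q.
Proof.
destruct p as [[x y] z].
destruct (sign_stable x) as [d1 [H1 K1]], (sign_stable y) as [d2 [H2 K2]],
  (sign_stable z) as [d3 [H3 K3]].
exists (Rmin d1 (Rmin d2 d3)); split; [repeat apply Rmin_glb_lt; auto |].
intros [[x' y'] z'] Hq; rewrite dist3_norm3 in Hq.
destruct (norm3_coord (x - x') (y - y') (z - z')) as [E1 [E2 E3]].
rewrite Rabs_minus_sym in E1, E2, E3.
pose proof (Rmin_l d1 (Rmin d2 d3)); pose proof (Rmin_r d1 (Rmin d2 d3)).
pose proof (Rmin_l d2 d3); pose proof (Rmin_r d2 d3).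
repeat split; [apply K1 | apply K2 | apply K3]; lra.
Qed.

Lemma same_face_sym p q : same_face p q -> same_face q p.
Proof.
destruct p as [[x y] z], q as [[x' y'] z']; unfold same_face.
rewrite (Rmult_comm x'), (Rmult_comm y'), (Rmult_comm z'); auto.
Qed.

(* A path may cross edges infinitely often, but each [g t] shares a closed face
   with all nearby [g s]; so [phi (g t) - L t] is locally nonincreasing. *)
Lemma reach_lower (phi : space -> R) p q l :
  (forall q q', X q -> X q' -> same_face q q' -> phi q' - phi q <= dist3 q q') ->
  reach p q l -> phi q - phi p <= l.
Proof.
intros Hphi [g [L [[Cg [Xg [<- <-]]] [HL Hl]]]].
enough (phi (g 1) - L 1 <= phi (g 0) - L 0) by lra.
apply (locally_nonincreasing (fun t => phi (g t) - L t)).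
rewrite continuous_on_dist3 in Cg.
intros t Ht; destruct (same_face_near (g t)) as [e [He Kf]].
destruct (Cg t Ht e He) as [d [Hd Kd]].
exists d; split; [exact Hd |]; intros s Hs Hst.
specialize (Kd s Hs Hst); apply Kf in Kd; split; intro Hle.
- pose proof (Hphi _ _ (Xg s Hs) (Xg t Ht) (same_face_sym _ _ Kd)).
  pose proof (HL s t (proj1 Hs) Hle (proj2 Ht)); lra.
- pose proof (Hphi _ _ (Xg t Ht) (Xg s Hs) Kd).
  pose proof (HL t s (proj1 Ht) Hle (proj2 Hs)); lra.
Qed.

(** * The intrinsic metric is finite and satisfies the metric laws *)

Lemma circumradius_pos : 0 < circumradius.
Proof. apply sqrt_lt_R0; lra. Qed.

Lemma reach_vertex p : X p -> exists l, reach p (circumradius, 0, 0) l.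
Proof.
pose proof circumradius_pos as Hc.
assert (HV : X (circumradius, 0, 0)).
{ unfold X; rewrite Rabs_R0, Rabs_pos_eq; lra. }
destruct p as [[x y] z]; intro Hp; destruct (Rle_dec 0 x) as [Hx | Hx].
- eexists; apply reach_segment; auto; unfold same_face; repeat split; nra.
(* From the half with negative first coordinate the route passes through a vertex on the third axis,
   which shares a face with [p] and one with the target. *)
- set (e := if Rle_dec 0 z then circumradius else - circumradius).
  assert (He : Rabs e = circumradius /\ 0 <= z * e).
  { unfold e; destruct Rle_dec; (split; [| nra]);
      [apply Rabs_pos_eq | rewrite Rabs_left1]; lra. }
  assert (HE : X (0, 0, e)) by (unfold X; rewrite Rabs_R0; lra).
  eexists; eapply reach_trans; apply reach_segment; eauto; unfold same_face;
    repeat split; nra.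
Qed.

Lemma reach_exists p q : X p -> X q -> exists l, reach p q l.
Proof.
intros Hp Hq; destruct (reach_vertex p Hp) as [l Hl], (reach_vertex q Hq) as [l' Hl'].
exists (l + l'); eapply reach_trans; [exact Hl | apply reach_sym; exact Hl'].
Qed.

Lemma dX_ge p q m : X p -> X q -> (forall l, reach p q l -> m <= l) -> m <= dX p q.
Proof.
intros Hp Hq; destruct (reach_exists p q Hp Hq) as [l Hl].
apply (dX_is_glb p q l Hl).
Qed.

Lemma dX_nonneg p q : X p -> X q -> 0 <= dX p q.
Proof. intros; apply dX_ge; auto; apply reach_nonneg. Qed.

Lemma dX_triangle p q s : X p -> X q -> X s -> dX p s <= dX p q + dX q s.
Proof.
intros Hp Hq Hs.
enough (dX p s - dX q s <= dX p q) by lra.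
apply dX_ge; auto; intros l Hl.
enough (dX p s - l <= dX q s) by lra.
apply dX_ge; auto; intros l' Hl'.
pose proof (dX_le _ _ _ (reach_trans _ _ _ _ _ Hl Hl')); lra.
Qed.

Lemma dX_sym p q : X p -> X q -> dX p q = dX q p.
Proof.
intros Hp Hq; apply Rle_antisym; apply dX_ge; auto; intros l Hl; apply dX_le, reach_sym, Hl.
Qed.

(** * Symmetries of the octahedron *)

Definition symmetry (h : space -> space) : Prop :=
  (forall q, X q -> X (h q)) /\ (forall q q', dist3 (h q) (h q') = dist3 q q') /\
  (forall q, h (h q) = q).

Lemma dX_symmetry h p q : symmetry h -> X p -> X q -> dX (h p) (h q) = dX p q.
Proof.
intros [HX [Hd Hi]] Hp Hq; apply Rle_antisym; apply dX_ge; auto; intros l Hl; apply dX_le.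
- apply reach_map; auto.
- rewrite <- (Hi p), <- (Hi q); apply reach_map; auto.
Qed.

Lemma dX_same_face p q : X p -> X q -> same_face p q -> dX p q <= dist3 p q.
Proof. intros; apply dX_le, reach_segment; auto. Qed.

Definition swap12 (q : space) : space := let '(x, y, z) := q in (y, x, z).
Definition swap23 (q : space) : space := let '(x, y, z) := q in (x, z, y).

Lemma symmetry_A : symmetry A.
Proof.
split; [| split].
- intros [[x y] z]; unfold X, A; rewrite !Rabs_Ropp; auto.
- intros [[x y] z] [[x' y'] z']; unfold dist3, A; f_equal; ring.
- intros [[x y] z]; unfold A; rewrite !Ropp_involutive; reflexivity.
Qed.

Lemma symmetry_swap12 : symmetry swap12.
Proof.
split; [| split].
- intros [[x y] z]; unfold X, swap12; lra.
- intros [[x y] z] [[x' y'] z']; unfold dist3, swap12; f_equal; ring.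
- intros [[x y] z]; reflexivity.
Qed.

Lemma symmetry_swap23 : symmetry swap23.
Proof.
split; [| split].
- intros [[x y] z]; unfold X, swap23; lra.
- intros [[x y] z] [[x' y'] z']; unfold dist3, swap23; f_equal; ring.
- intros [[x y] z]; reflexivity.
Qed.

(** * The distance to the antipodal face *)

(* [(ai, aj, ak)] are the absolute values of the coordinates of a point [q] of a face,
   [(pi, pj, pk)] the nonnegative coordinates of a point [p].  Crossing the edge on which
   coordinate [i] changes sign unfolds the image [(Pi, Pj, Pk)] of [p] to
   [(- Pi, Pj + Pi, Pk + Pi)]; [unfoldN] is the distance from [q] to the image of [p]
   after the first [N] of the crossings [i], [j], [k]. *)
Definition unfold1 (pi pj pk ai aj ak : R) : R :=
  norm3 (ai + pi) (aj - (pj + pi)) (ak - (pk + pi)).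

Definition unfold2 (pi pj pk ai aj ak : R) : R :=
  norm3 (ai - pj) (aj + (pi + pj)) (ak - (2 * pi + pj + pk)).

Definition unfold3 (pi pj pk ai aj ak : R) : R :=
  norm3 (ai - (2 * pi + 2 * pj + pk)) (aj - (pi + pk)) (ak + (2 * pi + pj + pk)).

Definition face_dist (p1 p2 p3 : R) (s1 s2 s3 : bool) (a1 a2 a3 : R) : R :=
  match s1, s2, s3 with
  | true, true, true => norm3 (a1 - p1) (a2 - p2) (a3 - p3)
  | false, true, true => unfold1 p1 p2 p3 a1 a2 a3
  | true, false, true => unfold1 p2 p1 p3 a2 a1 a3
  | true, true, false => unfold1 p3 p1 p2 a3 a1 a2
  | false, false, true => Rmin (unfold2 p1 p2 p3 a1 a2 a3) (unfold2 p2 p1 p3 a2 a1 a3)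
  | false, true, false => Rmin (unfold2 p1 p3 p2 a1 a3 a2) (unfold2 p3 p1 p2 a3 a1 a2)
  | true, false, false => Rmin (unfold2 p2 p3 p1 a2 a3 a1) (unfold2 p3 p2 p1 a3 a2 a1)
  | false, false, false =>
      Rmin (Rmin (unfold3 p1 p2 p3 a1 a2 a3) (unfold3 p2 p1 p3 a2 a1 a3))
        (Rmin (Rmin (unfold3 p1 p3 p2 a1 a3 a2) (unfold3 p3 p1 p2 a3 a1 a2))
           (Rmin (unfold3 p2 p3 p1 a2 a3 a1) (unfold3 p3 p2 p1 a3 a2 a1)))
  end.

Lemma norm3_lipschitz u1 u2 u3 v1 v2 v3 :
  norm3 u1 u2 u3 - norm3 v1 v2 v3 <= norm3 (v1 - u1) (v2 - u2) (v3 - u3).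
Proof.
pose proof (norm3_triangle v1 v2 v3 (u1 - v1) (u2 - v2) (u3 - v3)) as H.
replace (v1 + (u1 - v1)) with u1 in H by ring.
replace (v2 + (u2 - v2)) with u2 in H by ring.
replace (v3 + (u3 - v3)) with u3 in H by ring.
replace (norm3 (v1 - u1) (v2 - u2) (v3 - u3)) with (norm3 (u1 - v1) (u2 - v2) (u3 - v3));
  [lra | unfold norm3; f_equal; ring].
Qed.

Lemma norm3_le x y z x' y' z' :
  x ^ 2 + y ^ 2 + z ^ 2 <= x' ^ 2 + y' ^ 2 + z' ^ 2 -> norm3 x y z <= norm3 x' y' z'.
Proof. apply sqrt_le_1_alt. Qed.

Lemma norm3_eq x y z x' y' z' :
  x ^ 2 + y ^ 2 + z ^ 2 = x' ^ 2 + y' ^ 2 + z' ^ 2 -> norm3 x y z = norm3 x' y' z'.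
Proof. intro H; unfold norm3; f_equal; exact H. Qed.

Lemma Rmin_lipschitz a b a' b' d :
  a - a' <= d -> b - b' <= d -> Rmin a b - Rmin a' b' <= d.
Proof. intros; unfold Rmin; repeat destruct Rle_dec; lra. Qed.

Lemma face_dist_lipschitz p1 p2 p3 s1 s2 s3 a1 a2 a3 b1 b2 b3 :
  face_dist p1 p2 p3 s1 s2 s3 b1 b2 b3 - face_dist p1 p2 p3 s1 s2 s3 a1 a2 a3 <=
  norm3 (a1 - b1) (a2 - b2) (a3 - b3).
Proof.
destruct s1, s2, s3; simpl; unfold unfold1, unfold2, unfold3;
  repeat apply Rmin_lipschitz;
  (eapply Rle_trans; [apply norm3_lipschitz | apply norm3_le; nra]).
Qed.

(** * Agreement of the unfolded distances on common edges *)

Lemma unfold1_edge pi pj pk aj ak : aj + ak = pi + pj + pk ->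
  norm3 (0 - pi) (aj - pj) (ak - pk) = unfold1 pi pj pk 0 aj ak.
Proof.
intro H; apply norm3_eq; replace ak with (pi + pj + pk - aj) by lra; ring.
Qed.

Lemma unfold2_edge pi pj pk ai ak : ai + ak = pi + pj + pk ->
  unfold1 pi pj pk ai 0 ak = unfold2 pi pj pk ai 0 ak.
Proof.
intro H; apply norm3_eq; replace ak with (pi + pj + pk - ai) by lra; ring.
Qed.

Lemma unfold3_edge pi pj pk ai aj : ai + aj = pi + pj + pk ->
  unfold2 pi pj pk ai aj 0 = unfold3 pi pj pk ai aj 0.
Proof.
intro H; apply norm3_eq; replace aj with (pi + pj + pk - ai) by lra; ring.
Qed.

Section Domination.

Variables pi pj pk : R.
Hypotheses (Hi : 0 <= pi) (Hj : 0 <= pj) (Hk : 0 <= pk).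

(** On an edge, the orders of crossings that do not end with this edge give distances at least as
    large. Here the squares differ by [6 * ai * pj]. *)
Lemma unfold2_edge_le ai ak : 0 <= ai -> 0 <= ak -> ai + ak = pi + pj + pk ->
  unfold2 pi pj pk ai 0 ak <= unfold2 pj pi pk 0 ai ak.
Proof.
intros Ha Hb H; apply norm3_le; replace ak with (pi + pj + pk - ai) by lra; nra.
Qed.

(** The squares differ by [6 * aj * (pi + pk)]. *)
Lemma unfold3_edge_le_turn ai aj : 0 <= ai -> 0 <= aj -> ai + aj = pi + pj + pk ->
  unfold3 pi pj pk ai aj 0 <= unfold3 pi pk pj ai 0 aj.
Proof.
intros Ha Hb H; apply norm3_le; replace pk with (ai + aj - pi - pj) in * by lra; nra.
Qed.

(** The squares differ by [6 * (ai + 2 * aj) * pk]. *)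
Lemma unfold3_edge_le_far ai aj : 0 <= ai -> 0 <= aj -> ai + aj = pi + pj + pk ->
  unfold3 pi pj pk ai aj 0 <= unfold3 pk pi pj 0 ai aj.
Proof.
intros Ha Hb H; apply norm3_le; replace pk with (ai + aj - pi - pj) in * by lra; nra.
Qed.

End Domination.

Ltac split_Rmin a b :=
  pose proof (Rmin_l a b); pose proof (Rmin_r a b);
  let m := fresh "m" in set (m := Rmin a b) in *; clearbody m.

Ltac lra_Rmin :=
  apply Rle_antisym; repeat apply Rmin_glb;
  repeat match goal with
  | |- context [Rmin ?a ?b] => split_Rmin a b
  | _ : context [Rmin ?a ?b] |- _ => split_Rmin a b
  end; lra.

Section FaceDist.

Variables p1 p2 p3 : R.
Hypotheses (H1 : 0 <= p1) (H2 : 0 <= p2) (H3 : 0 <= p3).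

Lemma unfold2_edge_min pi pj pk ai ak :
  0 <= pi -> 0 <= pj -> 0 <= pk -> 0 <= ai -> 0 <= ak -> ai + ak = pi + pj + pk ->
  unfold1 pi pj pk ai 0 ak = unfold2 pi pj pk ai 0 ak /\
  unfold2 pi pj pk ai 0 ak <= unfold2 pj pi pk 0 ai ak.
Proof. intros; split; [apply unfold2_edge | apply unfold2_edge_le]; auto. Qed.

Lemma unfold3_edge_min pi pj pk ai aj :
  0 <= pi -> 0 <= pj -> 0 <= pk -> 0 <= ai -> 0 <= aj -> ai + aj = pi + pj + pk ->
  unfold2 pi pj pk ai aj 0 = unfold3 pi pj pk ai aj 0 /\
  unfold3 pi pj pk ai aj 0 <= unfold3 pi pk pj ai 0 aj /\
  unfold3 pi pj pk ai aj 0 <= unfold3 pk pi pj 0 ai aj.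
Proof.
intros; split; [apply unfold3_edge |
  split; [apply unfold3_edge_le_turn | apply unfold3_edge_le_far]]; auto.
Qed.

(** On the side with one more negative coordinate the minimum is attained by an order crossing this
    edge last, and dropping that last crossing does not change the distance. *)
Lemma face_dist_edge1 s2 s3 a2 a3 : 0 <= a2 -> 0 <= a3 -> a2 + a3 = p1 + p2 + p3 ->
  face_dist p1 p2 p3 true s2 s3 0 a2 a3 = face_dist p1 p2 p3 false s2 s3 0 a2 a3.
Proof.
intros Ha Hb Hs; destruct s2, s3; unfold face_dist.
- apply unfold1_edge; lra.
- destruct (unfold2_edge_min p3 p1 p2 a3 a2) as [E1 E2]; try lra; lra_Rmin.
- destruct (unfold2_edge_min p2 p1 p3 a2 a3) as [E1 E2]; try lra; lra_Rmin.
- destruct (unfold3_edge_min p2 p3 p1 a2 a3) as [E1 [E2 E3]]; try lra.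
  destruct (unfold3_edge_min p3 p2 p1 a3 a2) as [F1 [F2 F3]]; try lra; lra_Rmin.
Qed.

Lemma face_dist_edge2 s1 s3 a1 a3 : 0 <= a1 -> 0 <= a3 -> a1 + a3 = p1 + p2 + p3 ->
  face_dist p1 p2 p3 s1 true s3 a1 0 a3 = face_dist p1 p2 p3 s1 false s3 a1 0 a3.
Proof.
intros Ha Hb Hs; destruct s1, s3; unfold face_dist.
- rewrite <- unfold1_edge by lra; apply norm3_eq; ring.
- destruct (unfold2_edge_min p3 p2 p1 a3 a1) as [E1 E2]; try lra.
  replace (unfold1 p3 p1 p2 a3 a1 0) with (unfold1 p3 p2 p1 a3 0 a1)
    by (apply norm3_eq; ring); lra_Rmin.
- destruct (unfold2_edge_min p1 p2 p3 a1 a3) as [E1 E2]; try lra; lra_Rmin.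
- destruct (unfold3_edge_min p1 p3 p2 a1 a3) as [E1 [E2 E3]]; try lra.
  destruct (unfold3_edge_min p3 p1 p2 a3 a1) as [F1 [F2 F3]]; try lra; lra_Rmin.
Qed.

Lemma face_dist_edge3 s1 s2 a1 a2 : 0 <= a1 -> 0 <= a2 -> a1 + a2 = p1 + p2 + p3 ->
  face_dist p1 p2 p3 s1 s2 true a1 a2 0 = face_dist p1 p2 p3 s1 s2 false a1 a2 0.
Proof.
intros Ha Hb Hs; destruct s1, s2; unfold face_dist.
- rewrite <- unfold1_edge by lra; apply norm3_eq; ring.
- destruct (unfold2_edge_min p2 p3 p1 a2 a1) as [E1 E2]; try lra.
  replace (unfold1 p2 p1 p3 a2 a1 0) with (unfold1 p2 p3 p1 a2 0 a1)
    by (apply norm3_eq; ring); lra_Rmin.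
- destruct (unfold2_edge_min p1 p3 p2 a1 a2) as [E1 E2]; try lra.
  replace (unfold1 p1 p2 p3 a1 a2 0) with (unfold1 p1 p3 p2 a1 0 a2)
    by (apply norm3_eq; ring); lra_Rmin.
- destruct (unfold3_edge_min p1 p2 p3 a1 a2) as [E1 [E2 E3]]; try lra.
  destruct (unfold3_edge_min p2 p1 p3 a2 a1) as [F1 [F2 F3]]; try lra; lra_Rmin.
Qed.

Definition nonneg (x : R) : bool := if Rle_dec 0 x then true else false.

Definition total_dist (q : space) : R :=
  let '(x, y, z) := q in
  face_dist p1 p2 p3 (nonneg x) (nonneg y) (nonneg z) (Rabs x) (Rabs y) (Rabs z).

Definition signed (s : bool) (x : R) : R := if s then x else - x.

Lemma signed_cases s x : 0 <= signed s x ->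
  Rabs x = signed s x /\ (s = nonneg x \/ x = 0).
Proof.
unfold signed, nonneg; intro H; destruct s, (Rle_dec 0 x); split; auto; try lra.
- apply Rabs_pos_eq, H.
- apply Rabs_left1; lra.
- apply Rabs_left1; lra.
Qed.

(** [nonneg] assigns zero coordinates to the positive side; the edge lemmas remove this bias, so
    that two points of a common closed face are compared within one branch of [face_dist]. *)
Lemma total_dist_face s1 s2 s3 x y z : X (x, y, z) -> p1 + p2 + p3 = circumradius ->
  0 <= signed s1 x -> 0 <= signed s2 y -> 0 <= signed s3 z ->
  total_dist (x, y, z) =
  face_dist p1 p2 p3 s1 s2 s3 (signed s1 x) (signed s2 y) (signed s3 z).
Proof.
unfold X, total_dist; intros HX Hc Sx Sy Sz.
pose proof (Rabs_pos x); pose proof (Rabs_pos y); pose proof (Rabs_pos z).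
destruct (signed_cases s1 x Sx) as [<- Ex], (signed_cases s2 y Sy) as [<- Ey],
  (signed_cases s3 z Sz) as [<- Ez].
assert (E1 : forall s2 s3, face_dist p1 p2 p3 (nonneg x) s2 s3 (Rabs x) (Rabs y) (Rabs z) =
  face_dist p1 p2 p3 s1 s2 s3 (Rabs x) (Rabs y) (Rabs z)).
{ intros; destruct Ex as [-> | ->]; [reflexivity |]; rewrite Rabs_R0 in *.
  destruct (nonneg 0), s1; try reflexivity; rewrite face_dist_edge1; auto; lra. }
assert (E2 : forall s1 s3, face_dist p1 p2 p3 s1 (nonneg y) s3 (Rabs x) (Rabs y) (Rabs z) =
  face_dist p1 p2 p3 s1 s2 s3 (Rabs x) (Rabs y) (Rabs z)).
{ intros; destruct Ey as [-> | ->]; [reflexivity |]; rewrite Rabs_R0 in *.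
  destruct (nonneg 0), s2; try reflexivity; rewrite face_dist_edge2; auto; lra. }
assert (E3 : forall s1 s2, face_dist p1 p2 p3 s1 s2 (nonneg z) (Rabs x) (Rabs y) (Rabs z) =
  face_dist p1 p2 p3 s1 s2 s3 (Rabs x) (Rabs y) (Rabs z)).
{ intros; destruct Ez as [-> | ->]; [reflexivity |]; rewrite Rabs_R0 in *.
  destruct (nonneg 0), s3; try reflexivity; rewrite face_dist_edge3; auto; lra. }
rewrite E1, E2, E3; reflexivity.
Qed.

Lemma common_sign x x' : 0 <= x * x' -> exists s, 0 <= signed s x /\ 0 <= signed s x'.
Proof.
intro H; destruct (Rle_dec 0 x) as [Hx | Hx], (Rle_dec 0 x') as [Hx' | Hx'].
- exists true; auto.
- exists false; simpl; split; nra.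
- exists false; simpl; split; nra.
- exists false; simpl; split; lra.
Qed.

Lemma total_dist_lipschitz q q' : p1 + p2 + p3 = circumradius ->
  X q -> X q' -> same_face q q' -> total_dist q' - total_dist q <= dist3 q q'.
Proof.
destruct q as [[x y] z], q' as [[x' y'] z']; intros Hc HX HX' [Fx [Fy Fz]].
destruct (common_sign x x' Fx) as [s1 [Sx Sx']], (common_sign y y' Fy) as [s2 [Sy Sy']],
  (common_sign z z' Fz) as [s3 [Sz Sz']].
rewrite (total_dist_face s1 s2 s3 x y z), (total_dist_face s1 s2 s3 x' y' z') by auto.
eapply Rle_trans; [apply face_dist_lipschitz |]; rewrite dist3_norm3.
apply norm3_le; destruct s1, s2, s3; simpl; nra.
Qed.

(** [total_dist] vanishes at [p] and is the minimum of the six image distances on the antipodal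
    face, so [reach_lower] bounds the length of every path. *)
Lemma dX_lower_antipodal w1 w2 w3 m : p1 + p2 + p3 = circumradius ->
  0 <= w1 -> 0 <= w2 -> 0 <= w3 -> w1 + w2 + w3 = circumradius ->
  m <= unfold3 p1 p2 p3 w1 w2 w3 -> m <= unfold3 p2 p1 p3 w2 w1 w3 ->
  m <= unfold3 p1 p3 p2 w1 w3 w2 -> m <= unfold3 p3 p1 p2 w3 w1 w2 ->
  m <= unfold3 p2 p3 p1 w2 w3 w1 -> m <= unfold3 p3 p2 p1 w3 w2 w1 ->
  m <= dX (p1, p2, p3) (A (w1, w2, w3)).
Proof.
intros Hc W1 W2 W3 Hw M1 M2 M3 M4 M5 M6.
assert (HXp : X (p1, p2, p3)) by (unfold X; rewrite !Rabs_pos_eq; auto).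
assert (HXw : X (A (w1, w2, w3))).
{ apply symmetry_A; unfold X; rewrite !Rabs_pos_eq; auto. }
apply dX_ge; auto; intros l Hl.
pose proof (reach_lower total_dist _ _ l
  (fun q q' => total_dist_lipschitz q q' Hc) Hl) as K.
unfold A in K, HXw.
rewrite (total_dist_face false false false) in K by (auto; simpl; lra).
rewrite (total_dist_face true true true) in K by (auto; simpl; lra).
simpl in K; rewrite !Ropp_involutive in K.
replace (norm3 (p1 - p1) (p2 - p2) (p3 - p3)) with 0 in K.
2:{ unfold norm3; replace (_ + _) with 0 by ring; rewrite sqrt_0; reflexivity. }
eapply Rle_trans; [| rewrite Rminus_0_r in K; exact K].
repeat apply Rmin_glb; auto.
Qed.

End FaceDist.

(* The segment from a point of a face to an image of [p] beyond edge [ak = 0] leaves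
   the face through that edge, since the other two coordinates stay nonnegative. *)
Lemma crossing ai aj ak Pi Pj Pk :
  0 <= ai -> 0 <= aj -> 0 <= ak -> 0 <= Pi -> 0 <= Pj -> Pk <= 0 ->
  ai + aj + ak = Pi + Pj + Pk ->
  exists bi bj, 0 <= bi /\ 0 <= bj /\ bi + bj = ai + aj + ak /\
    norm3 (ai - bi) (aj - bj) (ak - 0) + norm3 (bi - Pi) (bj - Pj) (0 - Pk) =
    norm3 (ai - Pi) (aj - Pj) (ak - Pk).
Proof.
intros Hi Hj Hk HPi HPj HPk Hs.
assert (exists t, 0 <= t <= 1 /\ ak + t * (Pk - ak) = 0) as [t [Ht Et]].
{ destruct (Req_dec (ak - Pk) 0) as [E | E].
  - exists 0; lra.
  - exists (ak / (ak - Pk)); split; [split |].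
    + apply Rle_div_r; lra.
    + apply Rle_div_l; lra.
    + field; exact E. }
exists (ai + t * (Pi - ai)), (aj + t * (Pj - aj)); split; [nra | split; [nra | split]].
- nra.
- replace (ai - (ai + t * (Pi - ai))) with (t * (ai - Pi)) by ring.
  replace (aj - (aj + t * (Pj - aj))) with (t * (aj - Pj)) by ring.
  replace (ak - 0) with (t * (ak - Pk)) by lra.
  replace (ai + t * (Pi - ai) - Pi) with ((1 - t) * (ai - Pi)) by ring.
  replace (aj + t * (Pj - aj) - Pj) with ((1 - t) * (aj - Pj)) by ring.
  replace (0 - Pk) with ((1 - t) * (ak - Pk)) by lra.
  rewrite !norm3_scale, !Rabs_pos_eq by lra; ring.
Qed.

Lemma X_signed x y z (s1 s2 s3 : bool) : 0 <= x -> 0 <= y -> 0 <= z ->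
  x + y + z = circumradius -> X (signed s1 x, signed s2 y, signed s3 z).
Proof.
intros Hx Hy Hz H; unfold X.
destruct s1, s2, s3; simpl; rewrite ?Rabs_Ropp, !Rabs_pos_eq; auto.
Qed.

(** * Upper bounds from segments to the images *)

Section UpperBound.

Variables p1 p2 p3 : R.
Hypotheses (H1 : 0 <= p1) (H2 : 0 <= p2) (H3 : 0 <= p3).
Hypothesis Hp : p1 + p2 + p3 = circumradius.

Lemma dX_step q q' d d' : X q -> X q' -> same_face q q' ->
  dX (p1, p2, p3) q <= d -> dist3 q q' = d' -> dX (p1, p2, p3) q' <= d' + d.
Proof.
intros Hq Hq' Hf Hd <-.
pose proof (X_signed p1 p2 p3 true true true H1 H2 H3 Hp) as HX.
pose proof (dX_triangle _ q q' HX Hq Hq').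
pose proof (dX_same_face q q' Hq Hq' Hf); simpl in *; lra.
Qed.

Variables a1 a2 a3 : R.
Hypotheses (A1 : 0 <= a1) (A2 : 0 <= a2) (A3 : 0 <= a3).
Hypothesis Ha : a1 + a2 + a3 = circumradius.

Lemma dX_le_unfold0 : dX (p1, p2, p3) (a1, a2, a3) <= norm3 (a1 - p1) (a2 - p2) (a3 - p3).
Proof.
replace (norm3 _ _ _) with (dist3 (p1, p2, p3) (a1, a2, a3))
  by (rewrite dist3_norm3; apply norm3_eq; ring).
apply dX_same_face; [apply (X_signed _ _ _ true true true) |
  apply (X_signed _ _ _ true true true) |]; auto; unfold same_face; repeat split; nra.
Qed.

End UpperBound.

Ltac step_dist := rewrite dist3_norm3; apply norm3_eq; ring.

(** Crossings are undone one at a time, here and in the next two lemmas: the segment to the image is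
    cut at the last edge crossed, and the rest of it has the length given there by the shorter
    sequence of crossings. *)
Lemma dX_le_unfold1 p1 p2 p3 a1 a2 a3 :
  0 <= p1 -> 0 <= p2 -> 0 <= p3 -> p1 + p2 + p3 = circumradius ->
  0 <= a1 -> 0 <= a2 -> 0 <= a3 -> a1 + a2 + a3 = circumradius ->
  dX (p1, p2, p3) (- a1, a2, a3) <= unfold1 p1 p2 p3 a1 a2 a3.
Proof.
intros.
destruct (crossing a2 a3 a1 (p2 + p1) (p3 + p1) (- p1)) as [b2 [b3 [B2 [B3 [Hb E]]]]];
  try lra.
replace (unfold1 p1 p2 p3 a1 a2 a3) with
  (norm3 (a2 - b2) (a3 - b3) (a1 - 0) + norm3 (b2 - (p2 + p1)) (b3 - (p3 + p1)) (0 - - p1))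
  by (rewrite E; apply norm3_eq; ring).
apply (dX_step p1 p2 p3) with (0, b2, b3); auto; try step_dist.
- apply (X_signed 0 b2 b3 true true true); lra.
- apply (X_signed a1 a2 a3 false true true); lra.
- unfold same_face; repeat split; nra.
- eapply Rle_trans; [apply dX_le_unfold0; lra |].
  rewrite unfold1_edge by lra; right; apply norm3_eq; ring.
Qed.

Lemma dX_le_unfold2 p1 p2 p3 a1 a2 a3 :
  0 <= p1 -> 0 <= p2 -> 0 <= p3 -> p1 + p2 + p3 = circumradius ->
  0 <= a1 -> 0 <= a2 -> 0 <= a3 -> a1 + a2 + a3 = circumradius ->
  dX (p1, p2, p3) (- a1, - a2, a3) <= unfold2 p1 p2 p3 a1 a2 a3.
Proof.
intros.
destruct (crossing a1 a3 a2 p2 (2 * p1 + p2 + p3) (- (p1 + p2)))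
  as [b1 [b3 [B1 [B3 [Hb E]]]]]; try lra.
match type of E with ?l = _ => replace (unfold2 p1 p2 p3 a1 a2 a3) with l
  by (rewrite E; apply norm3_eq; ring) end.
apply (dX_step p1 p2 p3) with (- b1, 0, b3); auto; try step_dist.
- pose proof (X_signed b1 0 b3 false true true) as K; apply K; lra.
- apply (X_signed a1 a2 a3 false false true); lra.
- unfold same_face; repeat split; nra.
- eapply Rle_trans; [apply dX_le_unfold1; lra |].
  rewrite unfold2_edge by lra; right; apply norm3_eq; ring.
Qed.

Lemma dX_le_unfold3 p1 p2 p3 a1 a2 a3 :
  0 <= p1 -> 0 <= p2 -> 0 <= p3 -> p1 + p2 + p3 = circumradius ->
  0 <= a1 -> 0 <= a2 -> 0 <= a3 -> a1 + a2 + a3 = circumradius ->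
  dX (p1, p2, p3) (- a1, - a2, - a3) <= unfold3 p1 p2 p3 a1 a2 a3.
Proof.
intros.
destruct (crossing a1 a2 a3 (2 * p1 + 2 * p2 + p3) (p1 + p3) (- (2 * p1 + p2 + p3)))
  as [b1 [b2 [B1 [B2 [Hb E]]]]]; try lra.
match type of E with ?l = _ => replace (unfold3 p1 p2 p3 a1 a2 a3) with l
  by (rewrite E; apply norm3_eq; ring) end.
apply (dX_step p1 p2 p3) with (- b1, - b2, 0); auto; try step_dist.
- pose proof (X_signed b1 b2 0 false false true) as K; apply K; lra.
- apply (X_signed a1 a2 a3 false false false); lra.
- unfold same_face; repeat split; nra.
- eapply Rle_trans; [apply dX_le_unfold2; lra |].
  rewrite unfold3_edge by lra; right; apply norm3_eq; ring.
Qed.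

Lemma dX_swap12 p1 p2 p3 q1 q2 q3 : X (p1, p2, p3) -> X (q1, q2, q3) ->
  dX (p1, p2, p3) (q1, q2, q3) = dX (p2, p1, p3) (q2, q1, q3).
Proof. intros; symmetry; exact (dX_symmetry swap12 _ _ symmetry_swap12 H H0). Qed.

Lemma dX_swap23 p1 p2 p3 q1 q2 q3 : X (p1, p2, p3) -> X (q1, q2, q3) ->
  dX (p1, p2, p3) (q1, q2, q3) = dX (p1, p3, p2) (q1, q3, q2).
Proof. intros; symmetry; exact (dX_symmetry swap23 _ _ symmetry_swap23 H H0). Qed.

(** * Maximizing the least distance to the images *)

(* Squared distances from the antipode of [(u, T)] to the images of [(x, Y)], both with
   second coordinates scaled by [sqrt 3].  In terms of [unfold3], the coordinates change sign
   in the orders 213 (A), 312 (A'), 132 (B), 231 (B'), 123 (C), 321 (C'). *)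
Definition imageA (x Y u T : R) : R := (u + x - 1 / 2) ^ 2 + (T - Y - 9 / 2) ^ 2 / 3.
Definition imageA' (x Y u T : R) : R := (u + x - 1 / 2) ^ 2 + (T - Y + 9 / 2) ^ 2 / 3.
Definition imageB (x Y u T : R) : R :=
  (u - 2 - x / 2 + Y / 2) ^ 2 + (T + 3 + Y / 2 + 3 * x / 2) ^ 2 / 3.
Definition imageB' (x Y u T : R) : R :=
  (u + 5 / 2 - x / 2 + Y / 2) ^ 2 + (T - 3 / 2 + Y / 2 + 3 * x / 2) ^ 2 / 3.
Definition imageC (x Y u T : R) : R :=
  (u - 2 - x / 2 - Y / 2) ^ 2 + (T - 3 - 3 * x / 2 + Y / 2) ^ 2 / 3.
Definition imageC' (x Y u T : R) : R :=
  (u + 5 / 2 - x / 2 - Y / 2) ^ 2 + (T + 3 / 2 - 3 * x / 2 + Y / 2) ^ 2 / 3.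

(* The points [u] where [imageC], resp. [imageC'], agrees with
   [imageA = imageA'] on the line [T = Y]. *)
Definition right_vertex (x Y : R) : R :=
  (6 * x + Y ^ 2 - Y - x * Y) / (3 + 3 * x + Y).
Definition left_vertex (x Y : R) : R :=
  (3 * x + Y + x * Y - Y ^ 2) / (6 - 3 * x - Y).

(* The common value of [imageA] and [imageA'] on the line [T = Y]. *)
Definition height2 (x u : R) : R := (u + x - 1 / 2) ^ 2 + 27 / 4.

Definition in_T (x Y : R) : Prop := 0 <= Y /\ Y <= 3 * x /\ x + Y <= 1.

Section Optimum.

Variables x Y u1 u2 : R.
Hypothesis HT : in_T x Y.
Hypothesis E1 : u1 * (3 + 3 * x + Y) = 6 * x + Y ^ 2 - Y - x * Y.
Hypothesis E2 : u2 * (6 - 3 * x - Y) = 3 * x + Y + x * Y - Y ^ 2.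

(** The equations for [u1] and [u2] are kept free of denominators so that all goals are polynomial.
    Both [u1 - x] and [x - u2] are the product in [P] divided by a positive number. *)
Lemma vertex_bounds :
  u2 <= x <= u1 /\ Y <= 3 * u2 /\ u1 <= 1 - Y /\ 2 * x - 1 + Y <= u2.
Proof.
destruct HT as [HY [H3 H1]].
assert (D1 : 0 < 3 + 3 * x + Y) by lra.
assert (D2 : 0 < 6 - 3 * x - Y) by lra.
assert (P : 0 <= (3 * x - Y) * (1 - x - Y)) by (apply Rmult_le_pos; lra).
repeat split.
- apply (Rmult_le_reg_r _ _ _ D2); rewrite E2; lra.
- apply (Rmult_le_reg_r _ _ _ D1); rewrite E1; lra.
- apply (Rmult_le_reg_r _ _ _ D2).
  replace (3 * u2 * (6 - 3 * x - Y)) with (3 * (u2 * (6 - 3 * x - Y))) by ring.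
  rewrite E2; nra.
- apply (Rmult_le_reg_r _ _ _ D1); rewrite E1; nra.
- apply (Rmult_le_reg_r _ _ _ D2); rewrite E2; nra.
Qed.

(** Squared distances to two images differ by an affine function of [(u, T)]. Expanding around the
    line [T = Y] makes the vanishing at the vertex visible, here and for the other images. *)
Lemma imageC_eq u T : imageC x Y u T =
  height2 x u + (3 + 3 * x + Y) * (u1 - u) - (T - Y) * (2 + x - Y) + (T - Y) ^ 2 / 3.
Proof.
unfold imageC, height2.
replace ((3 + 3 * x + Y) * (u1 - u)) with (u1 * (3 + 3 * x + Y) - u * (3 + 3 * x + Y)) by ring.
rewrite E1; field.
Qed.

Lemma imageC'_eq u T : imageC' x Y u T =
  height2 x u + (6 - 3 * x - Y) * (u - u2) + (T - Y) * (1 - x + Y) + (T - Y) ^ 2 / 3.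
Proof.
unfold imageC', height2.
replace ((6 - 3 * x - Y) * (u - u2)) with (u * (6 - 3 * x - Y) - u2 * (6 - 3 * x - Y)) by ring.
rewrite E2; field.
Qed.

Lemma imageB_eq u T : imageB x Y u T =
  height2 x u + (3 + 3 * x + Y) * (u1 - u) + Y * (2 + 2 * x + 2 * u)
  + (T - Y) * (2 + x + Y) + (T - Y) ^ 2 / 3.
Proof.
unfold imageB, height2.
replace ((3 + 3 * x + Y) * (u1 - u)) with (u1 * (3 + 3 * x + Y) - u * (3 + 3 * x + Y)) by ring.
rewrite E1; field.
Qed.

Lemma imageB'_eq u : imageB' x Y u Y =
  height2 x u + (6 - 3 * x - Y) * (u - u2) + Y * (2 + 2 * x + 2 * u).
Proof.
unfold imageB', height2.
replace ((6 - 3 * x - Y) * (u - u2)) with (u * (6 - 3 * x - Y) - u2 * (6 - 3 * x - Y)) by ring.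
rewrite E2; field.
Qed.

Lemma imageA_eq u T : imageA x Y u T = height2 x u - 3 * (T - Y) + (T - Y) ^ 2 / 3.
Proof. unfold imageA, height2; field. Qed.

Lemma imageA'_eq u T : imageA' x Y u T = height2 x u + 3 * (T - Y) + (T - Y) ^ 2 / 3.
Proof. unfold imageA', height2; field. Qed.

Variable m : R.
Hypothesis M1 : height2 x u1 <= m.
Hypothesis M2 : height2 x u2 <= m.

Definition optimal (u T : R) : Prop :=
  T = Y /\ ((u = u1 /\ height2 x u1 = m) \/ (u = u2 /\ height2 x u2 = m)).

(** A strictly convex parabola on an interval is largest at the ends, and only there. *)
Lemma height2_middle u : u2 <= u <= u1 ->
  height2 x u <= m /\ (m <= height2 x u -> u = u1 \/ u = u2).
Proof.
unfold height2 in *; intro Hu; split.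
- destruct (Rle_lt_dec 0 (u1 + u + 2 * x - 1)).
  + assert (0 <= (u1 - u) * (u1 + u + 2 * x - 1)) by (apply Rmult_le_pos; lra); nra.
  + assert (0 <= (u - u2) * (1 - 2 * x - u - u2)) by (apply Rmult_le_pos; lra); nra.
- intro H; destruct (Req_dec u u1) as [| N1]; [left; auto |].
  destruct (Req_dec u u2) as [| N2]; [right; auto | exfalso].
  destruct (Rlt_le_dec 0 (u1 + u + 2 * x - 1)).
  + assert (0 < (u1 - u) * (u1 + u + 2 * x - 1)) by (apply Rmult_lt_0_compat; lra); nra.
  + assert (0 < (u - u2) * (1 - 2 * x - u - u2)) by (apply Rmult_lt_0_compat; lra); nra.
Qed.

(** Leaving the line by [t] towards one mirror image lowers the squared distance to it by
    [3 * t - t ^ 2 / 3], which is positive for [0 < t < 9]. *)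
Lemma middle_range u T : u2 <= u <= u1 ->
  (0 <= T - Y < 9 /\ m <= imageA x Y u T) \/ (0 <= Y - T < 9 /\ m <= imageA' x Y u T) ->
  optimal u T.
Proof.
intros Hu H; destruct (height2_middle u Hu) as [Hm Hm'].
assert (K : forall t, 0 <= t < 9 -> 0 <= 3 * t - t ^ 2 / 3 /\ (3 * t - t ^ 2 / 3 <= 0 -> t = 0)).
{ intros t Ht; split; [nra |]; intro N.
  destruct (Rle_lt_or_eq_dec 0 t (proj1 Ht)) as [Hp |]; [exfalso; nra | auto]. }
assert (HT0 : T = Y /\ m <= height2 x u).
{ destruct H as [[Ht H] | [Ht H]]; [rewrite imageA_eq in H | rewrite imageA'_eq in H];
    destruct (K _ Ht) as [K1 K2]; (split; [| lra]);
    [assert (T - Y = 0) by (apply K2; lra) | assert (Y - T = 0) by (apply K2; lra)]; lra. }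
destruct HT0 as [HT0 Hm'']; split; [exact HT0 |].
destruct (Hm' Hm'') as [-> | ->]; [left | right]; split; auto; lra.
Qed.

Lemma height2_right u : height2 x u = height2 x u1 + (u - u1) * (u + u1 + 2 * x - 1).
Proof. unfold height2; field. Qed.

Lemma height2_left u : height2 x u = height2 x u2 + (u2 - u) * (1 - 2 * x - u - u2).
Proof. unfold height2; field. Qed.

(** Weighting the two bounds by [S] and [W] cancels [t] and leaves [h * (V * W) <= h * (P * S)]. *)
Lemma opposite_bounds h t P S V W :
  0 < h -> 0 <= t -> 0 < V -> 0 <= S -> 0 <= W ->
  t * W <= h * P -> h * V <= t * S -> P * S < V * W -> False.
Proof.
intros Hh Ht HV HS HW HP HQ HK.
assert (0 < h * (V * W - P * S)) by (apply Rmult_lt_0_compat; lra).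
assert (0 <= S * (h * P - t * W)) by (apply Rmult_le_pos; lra).
assert (0 <= W * (t * S - h * V)) by (apply Rmult_le_pos; lra).
lra.
Qed.

(** To the right of [u1], image C alone excludes points on or above the line; below it, descending
    moves away from C but towards A', and [opposite_bounds] plays one against the other. To the left
    of [u2], C' and A do the same with up and down exchanged. *)
Lemma optimum_antipodal u T : 0 <= 1 + 2 * u -> 0 <= 1 - u + T -> 0 <= 1 - u - T ->
  m <= imageA x Y u T -> m <= imageA' x Y u T ->
  m <= imageC x Y u T -> m <= imageC' x Y u T -> optimal u T.
Proof.
intros W0 W1 W2 HA HA' HC HC'.
pose proof vertex_bounds as [[B1 B2] [B3 [B4 B5]]].
destruct HT as [HY [H3 H1]].
destruct (Rlt_le_dec u1 u) as [Hr | Hr];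
  [exfalso | destruct (Rlt_le_dec u u2) as [Hl | Hl]; [exfalso |]].
- rewrite imageC_eq, height2_right in HC; rewrite imageA'_eq, height2_right in HA'.
  destruct (Rle_lt_dec Y T) as [Ht | Ht].
  + assert (0 < (u - u1) * (4 + x + Y - u - u1)) by (apply Rmult_lt_0_compat; lra).
    assert (0 <= (T - Y) * (2 + x - Y - (T - Y) / 3)) by (apply Rmult_le_pos; lra).
    lra.
  + apply (opposite_bounds (u - u1) (Y - T) (u + u1 + 2 * x - 1) (2 + x - Y + (Y - T) / 3)
      (4 + x + Y - u - u1) (3 - (Y - T) / 3)); try lra.
    assert (0 <= (5 + x - Y) * (2 - (Y - T) - u - u1)) by (apply Rmult_le_pos; lra).
    assert (0 <= (1 - x - Y) * (1 + x)) by (apply Rmult_le_pos; lra).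
    assert (0 <= (Y - T) * (3 / 4 - Y)) by (apply Rmult_le_pos; lra).
    assert (0 <= x * Y) by (apply Rmult_le_pos; lra).
    lra.
- rewrite imageC'_eq, height2_left in HC'; rewrite imageA_eq, height2_left in HA.
  destruct (Rle_lt_dec T Y) as [Ht | Ht].
  + assert (0 < (u2 - u) * (u + u2 + 4 - x - Y)) by (apply Rmult_lt_0_compat; lra).
    assert (0 <= (Y - T) * ((1 - x + Y - (Y - T) / 3) + (u2 - u) / 3)) by (apply Rmult_le_pos; lra).
    assert (0 <= (u2 - u) * (3 - (Y - T))) by (apply Rmult_le_pos; lra).
    lra.
  + apply (opposite_bounds (u2 - u) (T - Y) (1 - 2 * x - u - u2) (1 - x + Y + (T - Y) / 3)
      (u + u2 + 5 - x - Y) (3 - (T - Y) / 3)); try lra.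
    assert (0 <= (3 / 2 - (1 - 2 * x - u - u2)) * (1 - x + Y + (T - Y) / 3))
      by (apply Rmult_le_pos; lra).
    assert (0 <= (u + u2 + 5 - x - Y - 7 / 2) * (3 - (T - Y) / 3))
      by (apply Rmult_le_pos; lra).
    lra.
- apply middle_range; [lra |].
  destruct (Rle_lt_dec Y T); [left | right]; split; auto; lra.
Qed.

(** The face across an edge of the antipodal face is rotated into the plane of the latter, and
    [(u, T)] lies beyond that edge. The images used, here and for the two other edges, are ones
    whose last crossing is this edge. The conclusion puts the point on the edge, hence in the closed
    antipodal face. *)
Lemma optimum_face3 u T : 0 <= 2 + u - T -> u <= 1 -> 1 - u - T <= 0 ->
  m <= imageA x Y u T -> m <= imageC x Y u T -> 1 - u - T = 0.
Proof.
intros W0 W1 W2 HA HC.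
pose proof vertex_bounds as [[B1 B2] [B3 [B4 B5]]].
destruct HT as [HY [H3 H1]].
destruct (Rlt_le_dec u1 u) as [Hr | Hr];
  [exfalso | destruct (Rlt_le_dec u u2) as [Hl | Hl]; [exfalso |]].
- rewrite imageC_eq, height2_right in HC.
  destruct (Rle_lt_dec Y T) as [Ht | Ht].
  + assert (0 < (u - u1) * (4 + x + Y - u - u1)) by (apply Rmult_lt_0_compat; lra).
    assert (0 <= (T - Y) * (2 + x - Y - (T - Y) / 3)) by (apply Rmult_le_pos; lra).
    lra.
  + assert (0 < (u - u1) * (2 + 2 * Y - u - u1 - (Y - T) / 3))
      by (apply Rmult_lt_0_compat; lra).
    assert (0 <= (u - u1 - (Y - T)) * (2 + x - Y + (Y - T) / 3)) by (apply Rmult_le_pos; lra).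
    lra.
- rewrite imageA_eq, height2_left in HA.
  assert (0 <= (u2 - u) * (3 / 2 - (1 - 2 * x - u - u2))) by (apply Rmult_le_pos; lra).
  assert (0 < (T - Y) * (2 - (3 / 2)) ) by (apply Rmult_lt_0_compat; lra).
  assert (0 <= (T - Y) * (1 - (T - Y) / 3)) by (apply Rmult_le_pos; lra).
  lra.
- destruct (middle_range u T) as [-> _]; [lra | left; split; auto; lra |]; lra.
Qed.

Lemma optimum_face2 u T : 0 <= 2 + u + T -> u <= 1 -> 1 - u + T <= 0 ->
  m <= imageA' x Y u T -> m <= imageB x Y u T -> 1 - u + T = 0.
Proof.
intros W0 W1 W2 HA HB.
pose proof vertex_bounds as [[B1 B2] [B3 [B4 B5]]].
destruct HT as [HY [H3 H1]].
destruct (Rlt_le_dec u1 u) as [Hr | Hr];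
  [exfalso | destruct (Rlt_le_dec u u2) as [Hl | Hl]; [exfalso |]].
- rewrite imageB_eq, height2_right in HB.
  assert (HV : 0 < (u - u1) * (4 + x + Y - u - u1)) by (apply Rmult_lt_0_compat; lra).
  assert (0 <= (Y - T - (Y + 1 - u)) * (2 + x + Y - (Y - T + (Y + 1 - u)) / 3))
    by (apply Rmult_le_pos; lra).
  destruct (Rle_lt_dec (1 - u) Y).
  + destruct (Rle_lt_or_eq_dec 0 Y HY) as [HY' | <-].
    * assert (0 <= (u - u1 - (Y - (1 - u))) * (4 + x + Y - u - u1))
        by (apply Rmult_le_pos; lra).
      assert (0 <= (Y - (1 - u)) * (4 + x + Y - u - u1 - (2 + x + 2 * Y + (1 - u))))
        by (apply Rmult_le_pos; lra).
      assert (0 < (Y + (1 - u)) * (2 * Y - (1 - u))) by (apply Rmult_lt_0_compat; lra).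
      assert (0 <= (Y - (1 - u)) * (2 * Y + (1 - u))) by (apply Rmult_le_pos; lra).
      assert (0 <= Y * (1 - u)) by (apply Rmult_le_pos; lra).
      lra.
    * assert (0 <= (0 - T) * (2 + x + 0 - (0 - T) / 3)) by (apply Rmult_le_pos; lra).
      lra.
  + assert (0 <= (1 - u - Y) * (2 + x - (1 - u) / 3)) by (apply Rmult_le_pos; lra).
    assert (0 <= Y * (1 - u)) by (apply Rmult_le_pos; lra).
    assert (0 <= Y * Y) by (apply Rmult_le_pos; lra).
    lra.
- rewrite imageA'_eq, height2_left in HA.
  assert (0 <= (u2 - u) * (3 / 2 - (1 - 2 * x - u - u2))) by (apply Rmult_le_pos; lra).
  assert (0 < (Y - T) * (7 / 4 - (3 / 2)) ) by (apply Rmult_lt_0_compat; lra).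
  assert (0 <= (Y - T) * (5 / 4 - (Y - T) / 3)) by (apply Rmult_le_pos; lra).
  lra.
- destruct (middle_range u T) as [-> _]; [lra | right; split; auto; lra |]; lra.
Qed.

Lemma optimum_face1 u T : 0 <= 2 + u + T -> 0 <= 2 + u - T -> 1 + 2 * u <= 0 ->
  m <= imageC' x Y u T -> 1 + 2 * u = 0.
Proof.
intros W0 W1 W2 HC.
pose proof vertex_bounds as [[B1 B2] [B3 [B4 B5]]].
destruct HT as [HY [H3 H1]].
rewrite imageC'_eq, height2_left in HC.
destruct (Req_dec (1 + 2 * u) 0) as [| N]; [auto | exfalso].
(* [e] measures how far the point lies beyond the edge. *)
set (e := - 1 / 2 - u) in *; replace u with (- 1 / 2 - e) in * by (unfold e; lra).
assert (0 <= (3 / 2 - e - T) * (1 - x + Y + (3 / 2 - e - Y + (T - Y)) / 3))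
  by (apply Rmult_le_pos; lra).
assert (0 < e * (4 - x - Y - e)) by (apply Rmult_lt_0_compat; lra).
assert (0 <= e * (3 / 2 - x + 2 * Y / 3 - e / 3)) by (apply Rmult_le_pos; lra).
assert (0 <= e * (3 / 2 - Y)) by (apply Rmult_le_pos; lra).
assert (0 <= u2 * (1 - x - Y)) by (apply Rmult_le_pos; lra).
assert (0 <= x * (1 - Y)) by (apply Rmult_le_pos; lra).
pose proof (pow2_ge_0 u2); pose proof (pow2_ge_0 Y).
lra.
Qed.
(** This is the height at [u = x], that is, at the antipode of [p]. It is a bound in [x] alone,
    strong enough for the faces that share no edge with the antipodal one. *)
Lemma height2_self : 4 * x ^ 2 - 2 * x + 7 <= m.
Proof.
pose proof vertex_bounds as [Hx _].
destruct (height2_middle x Hx) as [H _]; unfold height2 in H; lra.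
Qed.

(** This face meets the antipodal one in a single vertex, which is the farthest point when [p] is
    the vertex [(1, 0)]; hence the conclusion is [u = 1] and not a contradiction. *)
Lemma optimum_adjacent1 u T : 0 <= 1 + 2 * u -> 0 <= 1 - u + T -> 0 <= 1 - u - T ->
  m <= (u + 1 + x) ^ 2 + (T - Y) ^ 2 / 3 -> u = 1.
Proof.
intros W0 W1 W2 H; pose proof height2_self as HK; destruct HT as [HY [H3 H1]].
destruct (Req_dec u 1) as [| N]; [auto | exfalso].
assert (0 < (1 - u) * (4 + 2 * x - 4 * (1 - u) / 3 - 2 * Y / 3))
  by (apply Rmult_lt_0_compat; lra).
assert (0 <= (1 - u + Y - (T - Y)) * (1 - u + Y + (T - Y))) by (apply Rmult_le_pos; lra).
assert (0 <= (1 - x - Y) * (1 - x + Y)) by (apply Rmult_le_pos; lra).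
pose proof (pow2_ge_0 (1 - x)); lra.
Qed.

Lemma triangle_circumscribed u T :
  0 <= 1 + 2 * u -> 0 <= 1 - u + T -> 0 <= 1 - u - T -> u ^ 2 + T ^ 2 / 3 <= 1.
Proof.
intros W0 W1 W2.
assert (0 <= (1 - u - T) * (1 - u + T)) by (apply Rmult_le_pos; lra).
assert (0 <= (1 + 2 * u) * (1 - u)) by (apply Rmult_le_pos; lra).
lra.
Qed.

Lemma optimum_adjacent2 u T : 0 <= 1 + 2 * u -> 0 <= 1 - u + T -> 0 <= 1 - u - T ->
  m <= (u - (1 + x + Y) / 2) ^ 2 + (T + (3 - 3 * x + Y) / 2) ^ 2 / 3 -> False.
Proof.
intros W0 W1 W2 H; pose proof height2_self as HK; destruct HT as [HY [H3 H1]].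
pose proof (triangle_circumscribed u T W0 W1 W2).
assert (0 <= (1 - u - T) * (3 - 3 * x + Y)) by (apply Rmult_le_pos; lra).
assert (0 <= (1 + 2 * u) * (1 + x + Y + (3 - 3 * x + Y) / 3)) by (apply Rmult_le_pos; lra).
assert (0 <= Y * (3 / 4 - Y)) by (apply Rmult_le_pos; lra).
pose proof (pow2_ge_0 x); lra.
Qed.

Lemma optimum_adjacent3 u T : 0 <= 1 + 2 * u -> 0 <= 1 - u + T -> 0 <= 1 - u - T ->
  m <= (u - (1 + x - Y) / 2) ^ 2 + (T - (3 - 3 * x - Y) / 2) ^ 2 / 3 -> False.
Proof.
intros W0 W1 W2 H; pose proof height2_self as HK; destruct HT as [HY [H3 H1]].
pose proof (triangle_circumscribed u T W0 W1 W2).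
assert (0 <= (1 - u + T) * (3 - 3 * x - Y)) by (apply Rmult_le_pos; lra).
assert (0 <= (1 + 2 * u) * (1 + x - Y + (3 - 3 * x - Y) / 3)) by (apply Rmult_le_pos; lra).
assert (0 <= Y * (3 / 4 - Y)) by (apply Rmult_le_pos; lra).
pose proof (pow2_ge_0 x); lra.
Qed.

Lemma optimum_same u T : 0 <= 1 + 2 * u -> 0 <= 1 - u + T -> 0 <= 1 - u - T ->
  m <= (u - x) ^ 2 + (T - Y) ^ 2 / 3 -> False.
Proof.
intros W0 W1 W2 H; pose proof height2_self as HK; destruct HT as [HY [H3 H1]].
pose proof (triangle_circumscribed u T W0 W1 W2).
pose proof (triangle_circumscribed x Y ltac:(lra) ltac:(lra) ltac:(lra)).
pose proof (pow2_ge_0 (u + x)); pose proof (pow2_ge_0 (T + Y)).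
pose proof (pow2_ge_0 (4 * x - 1)); lra.
Qed.

End Optimum.

(** * Planar coordinates on a face *)

Definition bary1 (u T : R) : R := (1 + 2 * u) / 3.
Definition bary2 (u T : R) : R := (1 - u + T) / 3.
Definition bary3 (u T : R) : R := (1 - u - T) / 3.

Notation c := circumradius.

(* [pos x (sqrt 3 * y) = emb (x, y)]. *)
Definition pos (u T : R) : space := (c * bary1 u T, c * bary2 u T, c * bary3 u T).

Definition in_face (u T : R) : Prop := 0 <= 1 + 2 * u /\ 0 <= 1 - u + T /\ 0 <= 1 - u - T.

Lemma in_T_face x Y : in_T x Y -> in_face x Y.
Proof. unfold in_T, in_face; lra. Qed.

Lemma bary_sum u T : c * bary1 u T + c * bary2 u T + c * bary3 u T = c.
Proof. unfold bary1, bary2, bary3; field. Qed.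

Lemma bary_nonneg u T : in_face u T ->
  0 <= c * bary1 u T /\ 0 <= c * bary2 u T /\ 0 <= c * bary3 u T.
Proof.
pose proof circumradius_pos; intros [H1 [H2 H3]].
unfold bary1, bary2, bary3; repeat split; apply Rmult_le_pos; lra.
Qed.

Lemma pos_surj a1 a2 a3 : a1 + a2 + a3 = c ->
  exists u T, a1 = c * bary1 u T /\ a2 = c * bary2 u T /\ a3 = c * bary3 u T.
Proof.
pose proof circumradius_pos as Hc; intro H.
exists ((3 * a1 / c - 1) / 2), (3 * (a2 - a3) / (2 * c)); unfold bary1, bary2, bary3.
repeat split; [field; lra | |].
- transitivity ((c - a1 + a2 - a3) / 2); [lra | field; lra].
- transitivity ((c - a1 - a2 + a3) / 2); [lra | field; lra].
Qed.

Lemma pos_face u T : 0 <= c * bary1 u T -> 0 <= c * bary2 u T -> 0 <= c * bary3 u T ->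
  in_face u T.
Proof.
pose proof circumradius_pos; unfold in_face, bary1, bary2, bary3; intros H1 H2 H3.
repeat split.
- enough (0 <= (1 + 2 * u) / 3) by lra; apply (Rmult_le_reg_l c); lra.
- enough (0 <= (1 - u + T) / 3) by lra; apply (Rmult_le_reg_l c); lra.
- enough (0 <= (1 - u - T) / 3) by lra; apply (Rmult_le_reg_l c); lra.
Qed.

Lemma X_pos u T : in_face u T -> X (pos u T).
Proof.
intro H; destruct (bary_nonneg u T H) as [H1 [H2 H3]].
apply (X_signed _ _ _ true true true); auto; apply bary_sum.
Qed.

Lemma norm3_circumradius x y z :
  norm3 (c * x) (c * y) (c * z) ^ 2 = 3 / 2 * (x ^ 2 + y ^ 2 + z ^ 2).
Proof. rewrite norm3_sqr, <- circumradius_sqr; ring. Qed.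

Lemma unfold1_scale pi pj pk ai aj ak :
  unfold1 (c * pi) (c * pj) (c * pk) (c * ai) (c * aj) (c * ak) ^ 2 =
  3 / 2 * unfold1 pi pj pk ai aj ak ^ 2.
Proof. unfold unfold1; rewrite !norm3_sqr, <- circumradius_sqr; ring. Qed.

Lemma unfold3_scale pi pj pk ai aj ak :
  unfold3 (c * pi) (c * pj) (c * pk) (c * ai) (c * aj) (c * ak) ^ 2 =
  3 / 2 * unfold3 pi pj pk ai aj ak ^ 2.
Proof. unfold unfold3; rewrite !norm3_sqr, <- circumradius_sqr; ring. Qed.

(** Rotating a point about the edge into the plane of the next face turns its coordinates into
    [(ai + ak, aj + ak, - ak)]. The third crossing therefore preserves the distance to the image. *)
Lemma unfold2_unfold3 pi pj pk ai aj ak : ai + aj + ak = pi + pj + pk ->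
  unfold2 pi pj pk ai aj ak = unfold3 pi pj pk (ai + ak) (aj + ak) (- ak).
Proof. intro H; apply norm3_eq; replace ak with (pi + pj + pk - ai - aj) by lra; ring. Qed.

Ltac planar :=
  rewrite unfold3_scale || rewrite unfold1_scale; unfold unfold1, unfold3;
  rewrite norm3_sqr; unfold bary1, bary2, bary3;
  unfold imageA, imageA', imageB, imageB', imageC, imageC'; field.

Section Planar.

Variables x Y u T : R.
Let p1 := c * bary1 x Y.
Let p2 := c * bary2 x Y.
Let p3 := c * bary3 x Y.
Let w1 := c * bary1 u T.
Let w2 := c * bary2 u T.
Let w3 := c * bary3 u T.

Lemma planarA : unfold3 p2 p1 p3 w2 w1 w3 ^ 2 = imageA x Y u T.
Proof. unfold p1, p2, p3, w1, w2, w3; planar. Qed.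
Lemma planarA' : unfold3 p3 p1 p2 w3 w1 w2 ^ 2 = imageA' x Y u T.
Proof. unfold p1, p2, p3, w1, w2, w3; planar. Qed.
Lemma planarB : unfold3 p1 p3 p2 w1 w3 w2 ^ 2 = imageB x Y u T.
Proof. unfold p1, p2, p3, w1, w2, w3; planar. Qed.
Lemma planarB' : unfold3 p2 p3 p1 w2 w3 w1 ^ 2 = imageB' x Y u T.
Proof. unfold p1, p2, p3, w1, w2, w3; planar. Qed.
Lemma planarC : unfold3 p1 p2 p3 w1 w2 w3 ^ 2 = imageC x Y u T.
Proof. unfold p1, p2, p3, w1, w2, w3; planar. Qed.
Lemma planarC' : unfold3 p3 p2 p1 w3 w2 w1 ^ 2 = imageC' x Y u T.
Proof. unfold p1, p2, p3, w1, w2, w3; planar. Qed.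

Lemma planar_adjacent1 :
  unfold1 p1 p2 p3 w1 w2 w3 ^ 2 = (u + 1 + x) ^ 2 + (T - Y) ^ 2 / 3.
Proof. unfold p1, p2, p3, w1, w2, w3; planar. Qed.
Lemma planar_adjacent2 :
  unfold1 p2 p1 p3 w2 w1 w3 ^ 2 =
  (u - (1 + x + Y) / 2) ^ 2 + (T + (3 - 3 * x + Y) / 2) ^ 2 / 3.
Proof. unfold p1, p2, p3, w1, w2, w3; planar. Qed.
Lemma planar_adjacent3 :
  unfold1 p3 p1 p2 w3 w1 w2 ^ 2 =
  (u - (1 + x - Y) / 2) ^ 2 + (T - (3 - 3 * x - Y) / 2) ^ 2 / 3.
Proof. unfold p1, p2, p3, w1, w2, w3; planar. Qed.
Lemma planar_same :
  norm3 (w1 - p1) (w2 - p2) (w3 - p3) ^ 2 = (u - x) ^ 2 + (T - Y) ^ 2 / 3.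
Proof.
unfold p1, p2, p3, w1, w2, w3; rewrite <- !Rmult_minus_distr_l, norm3_circumradius.
unfold bary1, bary2, bary3; field.
Qed.

End Planar.

Section UpperPermuted.

Variables p1 p2 p3 a1 a2 a3 : R.
Hypotheses (P1 : 0 <= p1) (P2 : 0 <= p2) (P3 : 0 <= p3) (HP : p1 + p2 + p3 = c).
Hypotheses (A1 : 0 <= a1) (A2 : 0 <= a2) (A3 : 0 <= a3) (HA : a1 + a2 + a3 = c).

Ltac on_X := unfold X; rewrite ?Rabs_Ropp, !Rabs_pos_eq; lra.

Lemma dX_le_unfold1_2 : dX (p1, p2, p3) (a1, - a2, a3) <= unfold1 p2 p1 p3 a2 a1 a3.
Proof. rewrite dX_swap12 by on_X; apply dX_le_unfold1; lra. Qed.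

Lemma dX_le_unfold1_3 : dX (p1, p2, p3) (a1, a2, - a3) <= unfold1 p3 p1 p2 a3 a1 a2.
Proof. rewrite dX_swap23, dX_swap12 by on_X; apply dX_le_unfold1; lra. Qed.

Lemma dX_le_unfold2_21 : dX (p1, p2, p3) (- a1, - a2, a3) <= unfold2 p2 p1 p3 a2 a1 a3.
Proof. rewrite dX_swap12 by on_X; apply dX_le_unfold2; lra. Qed.

Lemma dX_le_unfold2_13 : dX (p1, p2, p3) (- a1, a2, - a3) <= unfold2 p1 p3 p2 a1 a3 a2.
Proof. rewrite dX_swap23 by on_X; apply dX_le_unfold2; lra. Qed.

Lemma dX_le_unfold2_31 : dX (p1, p2, p3) (- a1, a2, - a3) <= unfold2 p3 p1 p2 a3 a1 a2.
Proof. rewrite dX_swap23, dX_swap12 by on_X; apply dX_le_unfold2; lra. Qed.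

Lemma dX_le_unfold2_32 : dX (p1, p2, p3) (a1, - a2, - a3) <= unfold2 p3 p2 p1 a3 a2 a1.
Proof. rewrite dX_swap12, dX_swap23, dX_swap12 by on_X; apply dX_le_unfold2; lra. Qed.

Lemma dX_le_unfold3_213 : dX (p1, p2, p3) (- a1, - a2, - a3) <= unfold3 p2 p1 p3 a2 a1 a3.
Proof. rewrite dX_swap12 by on_X; apply dX_le_unfold3; lra. Qed.

Lemma dX_le_unfold3_312 : dX (p1, p2, p3) (- a1, - a2, - a3) <= unfold3 p3 p1 p2 a3 a1 a2.
Proof. rewrite dX_swap23, dX_swap12 by on_X; apply dX_le_unfold3; lra. Qed.

Lemma dX_le_unfold3_321 : dX (p1, p2, p3) (- a1, - a2, - a3) <= unfold3 p3 p2 p1 a3 a2 a1.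
Proof. rewrite dX_swap12, dX_swap23, dX_swap12 by on_X; apply dX_le_unfold3; lra. Qed.

End UpperPermuted.

Lemma c_mult_nonneg z : 0 <= c * z -> 0 <= z.
Proof. pose proof circumradius_pos; intro; apply (Rmult_le_reg_l c); lra. Qed.

(** * Far points are Voronoi vertices *)

Section Farthest.

Variables x Y u1 u2 m : R.
Hypothesis HT : in_T x Y.
Hypothesis E1 : u1 * (3 + 3 * x + Y) = 6 * x + Y ^ 2 - Y - x * Y.
Hypothesis E2 : u2 * (6 - 3 * x - Y) = 3 * x + Y + x * Y - Y ^ 2.
Hypothesis M1 : height2 x u1 <= m.
Hypothesis M2 : height2 x u2 <= m.

Lemma far_image q n : X q -> m <= dX (pos x Y) q ^ 2 -> dX (pos x Y) q <= n -> m <= n ^ 2.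
Proof.
intros Hq Hm Hn; pose proof (dX_nonneg _ q (X_pos x Y (in_T_face x Y HT)) Hq); nra.
Qed.

Lemma far_antipodal u T : in_face u T -> m <= dX (pos x Y) (A (pos u T)) ^ 2 ->
  optimal x Y u1 u2 m u T.
Proof.
intros Hu Hm.
assert (K : forall n, dX (pos x Y) (A (pos u T)) <= n -> m <= n ^ 2).
{ intro n; apply far_image; [apply symmetry_A, X_pos, Hu | exact Hm]. }
destruct (bary_nonneg x Y (in_T_face x Y HT)) as [P1 [P2 P3]].
destruct (bary_nonneg u T Hu) as [W1 [W2 W3]].
pose proof (bary_sum x Y) as Hp; pose proof (bary_sum u T) as Hw.
destruct Hu as [U1 [U2 U3]].
apply optimum_antipodal; auto.
- rewrite <- planarA; apply K, dX_le_unfold3_213; auto.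
- rewrite <- planarA'; apply K, dX_le_unfold3_312; auto.
- rewrite <- planarC; apply K, dX_le_unfold3; auto.
- rewrite <- planarC'; apply K, dX_le_unfold3_321; auto.
Qed.

Lemma far_in_antipodal_face q1 q2 q3 : X (q1, q2, q3) ->
  m <= dX (pos x Y) (q1, q2, q3) ^ 2 -> q1 <= 0 /\ q2 <= 0 /\ q3 <= 0.
Proof.
intros Hq Hm.
assert (K : forall n, dX (pos x Y) (q1, q2, q3) <= n -> m <= n ^ 2).
{ intro n; apply far_image; auto. }
destruct (bary_nonneg x Y (in_T_face x Y HT)) as [P1 [P2 P3]].
pose proof (bary_sum x Y) as Hp; unfold X in Hq.
pose proof circumradius_pos as Hc.
assert (S : forall a, exists b s, 0 <= b /\ Rabs a = b /\ a = signed s b).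
{ intro a; destruct (Rle_dec 0 a).
  - exists a, true; rewrite Rabs_pos_eq by auto; auto.
  - exists (- a), false; rewrite Rabs_left1 by lra; simpl; lra. }
destruct (S q1) as [a1 [s1 [A1 [R1 ->]]]], (S q2) as [a2 [s2 [A2 [R2 ->]]]],
  (S q3) as [a3 [s3 [A3 [R3 ->]]]]; rewrite R1, R2, R3 in Hq; clear S R1 R2 R3 Hm.
destruct s1, s2, s3; simpl in *.
- destruct (pos_surj a1 a2 a3 Hq) as [u [T [-> [-> ->]]]].
  destruct (pos_face u T A1 A2 A3) as [U1 [U2 U3]]; exfalso.
  apply (optimum_same x Y u1 u2 HT E1 E2 m M1 M2 u T); auto.
  rewrite <- planar_same; apply K, dX_le_unfold0; auto.
- destruct (pos_surj a1 a2 a3 Hq) as [u [T [-> [-> ->]]]].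
  destruct (pos_face u T A1 A2 A3) as [U1 [U2 U3]]; exfalso.
  apply (optimum_adjacent3 x Y u1 u2 HT E1 E2 m M1 M2 u T); auto.
  rewrite <- planar_adjacent3; apply K, dX_le_unfold1_3; auto.
- destruct (pos_surj a1 a2 a3 Hq) as [u [T [-> [-> ->]]]].
  destruct (pos_face u T A1 A2 A3) as [U1 [U2 U3]]; exfalso.
  apply (optimum_adjacent2 x Y u1 u2 HT E1 E2 m M1 M2 u T); auto.
  rewrite <- planar_adjacent2; apply K, dX_le_unfold1_2; auto.
- enough (a1 = 0) by lra.
  destruct (pos_surj (- a1) (a2 + a1) (a3 + a1) ltac:(lra)) as [u [T [W1 [W2 W3]]]].
  assert (U1 : 0 <= bary2 u T + bary1 u T) by (apply c_mult_nonneg; lra).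
  assert (U2 : 0 <= bary3 u T + bary1 u T) by (apply c_mult_nonneg; lra).
  assert (U3 : 0 <= - bary1 u T) by (apply c_mult_nonneg; lra).
  unfold bary1, bary2, bary3 in U1, U2, U3.
  assert (Z : 1 + 2 * u = 0).
  { apply (optimum_face1 x Y u1 u2 HT E1 E2 m M2 u T); try lra.
    rewrite <- planarC', <- W1, <- W2, <- W3, <- unfold2_unfold3 by lra.
    apply K, dX_le_unfold2_32; auto. }
  replace (bary1 u T) with 0 in W1 by (unfold bary1; lra); lra.
- destruct (pos_surj a1 a2 a3 Hq) as [u [T [-> [-> ->]]]].
  destruct (pos_face u T A1 A2 A3) as [U1 [U2 U3]].
  assert (Z : u = 1).
  { apply (optimum_adjacent1 x Y u1 u2 HT E1 E2 m M1 M2 u T); auto.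
    rewrite <- planar_adjacent1; apply K, dX_le_unfold1; auto. }
  assert (T = 0) by lra; subst; unfold bary1, bary2, bary3; lra.
- enough (a2 = 0) by lra.
  destruct (pos_surj (a1 + a2) (- a2) (a3 + a2) ltac:(lra)) as [u [T [W1 [W2 W3]]]].
  assert (U1 : 0 <= bary1 u T + bary2 u T) by (apply c_mult_nonneg; lra).
  assert (U2 : 0 <= bary3 u T + bary2 u T) by (apply c_mult_nonneg; lra).
  assert (U3 : 0 <= - bary2 u T) by (apply c_mult_nonneg; lra).
  unfold bary1, bary2, bary3 in U1, U2, U3.
  assert (Z : 1 - u + T = 0).
  { apply (optimum_face2 x Y u1 u2 HT E1 E2 m M1 M2 u T); try lra.
    - rewrite <- planarA', <- W1, <- W2, <- W3, <- unfold2_unfold3 by lra.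
      apply K, dX_le_unfold2_31; auto.
    - rewrite <- planarB, <- W1, <- W2, <- W3, <- unfold2_unfold3 by lra.
      apply K, dX_le_unfold2_13; auto. }
  replace (bary2 u T) with 0 in W2 by (unfold bary2; lra); lra.
- enough (a3 = 0) by lra.
  destruct (pos_surj (a1 + a3) (a2 + a3) (- a3) ltac:(lra)) as [u [T [W1 [W2 W3]]]].
  assert (U1 : 0 <= bary1 u T + bary3 u T) by (apply c_mult_nonneg; lra).
  assert (U2 : 0 <= bary2 u T + bary3 u T) by (apply c_mult_nonneg; lra).
  assert (U3 : 0 <= - bary3 u T) by (apply c_mult_nonneg; lra).
  unfold bary1, bary2, bary3 in U1, U2, U3.
  assert (Z : 1 - u - T = 0).
  { apply (optimum_face3 x Y u1 u2 HT E1 E2 m M1 M2 u T); try lra.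
    - rewrite <- planarA, <- W1, <- W2, <- W3, <- unfold2_unfold3 by lra.
      apply K, dX_le_unfold2_21; auto.
    - rewrite <- planarC, <- W1, <- W2, <- W3, <- unfold2_unfold3 by lra.
      apply K, dX_le_unfold2; auto. }
  replace (bary3 u T) with 0 in W3 by (unfold bary3; lra); lra.
- lra.
Qed.

Lemma far_optimal q : X q -> m <= dX (pos x Y) q ^ 2 ->
  exists u, q = A (pos u Y) /\
    ((u = u1 /\ height2 x u1 = m) \/ (u = u2 /\ height2 x u2 = m)).
Proof.
destruct q as [[q1 q2] q3]; intros Hq Hm.
destruct (far_in_antipodal_face q1 q2 q3 Hq Hm) as [Q1 [Q2 Q3]].
assert (Hs : - q1 + - q2 + - q3 = c).
{ unfold X in Hq; rewrite !Rabs_left1 in Hq by auto; exact Hq. }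
destruct (pos_surj _ _ _ Hs) as [u [T [W1 [W2 W3]]]].
assert (EQ : (q1, q2, q3) = A (pos u T)).
{ unfold pos, A; rewrite <- W1, <- W2, <- W3, !Ropp_involutive; reflexivity. }
rewrite EQ in *.
destruct (far_antipodal u T) as [-> Hu]; [apply pos_face; lra | exact Hm |].
exists u; auto.
Qed.

(** All six images count here. On the line, C and C' are no nearer than A because [u] lies between
    the vertices, and B and B' exceed C and C' by [Y * (2 + 2 * x + 2 * u)]. *)
Lemma vertex_distance u : u2 <= u <= u1 -> in_face u Y -> height2 x u = m ->
  m <= dX (pos x Y) (A (pos u Y)) ^ 2.
Proof.
intros Hu Hf Hm.
destruct (bary_nonneg x Y (in_T_face x Y HT)) as [P1 [P2 P3]].
destruct (bary_nonneg u Y Hf) as [W1 [W2 W3]].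
pose proof (bary_sum x Y) as Hp; pose proof (bary_sum u Y) as Hw.
destruct (vertex_bounds x Y u1 u2 HT E1 E2) as [B1 [B2 [B3 B4]]].
destruct HT as [HY [H3 H1]].
assert (0 <= (3 + 3 * x + Y) * (u1 - u)) by (apply Rmult_le_pos; lra).
assert (0 <= (6 - 3 * x - Y) * (u - u2)) by (apply Rmult_le_pos; lra).
assert (0 <= Y * (2 + 2 * x + 2 * u)) by (apply Rmult_le_pos; lra).
assert (Hm0 : 0 <= m) by (rewrite <- Hm; unfold height2; pose proof (pow2_ge_0 (u + x - 1 / 2)); lra).
assert (L : forall n, m <= n ^ 2 -> 0 <= n -> sqrt m <= n).
{ intros n Hn Hn0; rewrite <- (sqrt_pow2 n Hn0); apply sqrt_le_1_alt, Hn. }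
assert (K : sqrt m <= dX (pos x Y) (A (pos u Y))).
{ apply dX_lower_antipodal; auto; apply L; try apply norm3_nonneg.
  - rewrite planarC, (imageC_eq x Y u1 E1); lra.
  - rewrite planarA, imageA_eq; lra.
  - rewrite planarB, (imageB_eq x Y u1 E1); lra.
  - rewrite planarA', imageA'_eq; lra.
  - rewrite planarB', (imageB'_eq x Y u2 E2); lra.
  - rewrite planarC', (imageC'_eq x Y u2 E2); lra. }
rewrite <- (pow2_sqrt m Hm0); apply pow_incr; split; [apply sqrt_pos | exact K].
Qed.

End Farthest.

(** * The farthest points of a point of T *)

Lemma right_vertex_eq x Y : in_T x Y ->
  right_vertex x Y * (3 + 3 * x + Y) = 6 * x + Y ^ 2 - Y - x * Y.
Proof. unfold in_T, right_vertex; intro H; field; lra. Qed.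

Lemma left_vertex_eq x Y : in_T x Y ->
  left_vertex x Y * (6 - 3 * x - Y) = 3 * x + Y + x * Y - Y ^ 2.
Proof. unfold in_T, left_vertex; intro H; field; lra. Qed.

Lemma vertices_bounds x Y : in_T x Y ->
  left_vertex x Y <= x <= right_vertex x Y /\ Y <= 3 * left_vertex x Y /\
  right_vertex x Y <= 1 - Y.
Proof.
intro H.
destruct (vertex_bounds x Y _ _ H (right_vertex_eq x Y H) (left_vertex_eq x Y H)) as [? [? [? ?]]].
auto.
Qed.

Lemma in_T_vertices x Y : in_T x Y -> in_T (right_vertex x Y) Y /\ in_T (left_vertex x Y) Y.
Proof. intro H; pose proof (vertices_bounds x Y H); unfold in_T in *; lra. Qed.

(** The maximum is exhibited, not obtained from compactness: a point at squared distance at least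
    [m] is one of the vertices by [far_optimal], and there the distance is controlled from both
    sides. *)
Lemma farthest_pos x Y q : in_T x Y ->
  farthest (pos x Y) q <->
  (q = A (pos (right_vertex x Y) Y) /\
   height2 x (left_vertex x Y) <= height2 x (right_vertex x Y)) \/
  (q = A (pos (left_vertex x Y) Y) /\
   height2 x (right_vertex x Y) <= height2 x (left_vertex x Y)).
Proof.
intro H.
pose proof (right_vertex_eq x Y H) as E1; pose proof (left_vertex_eq x Y H) as E2.
pose proof (vertices_bounds x Y H) as [B1 [B2 B3]].
destruct (in_T_vertices x Y H) as [T1 T2].
set (u1 := right_vertex x Y) in *; set (u2 := left_vertex x Y) in *.
set (m := Rmax (height2 x u1) (height2 x u2)).
pose proof (Rmax_l (height2 x u1) (height2 x u2)) as M1; fold m in M1.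
pose proof (Rmax_r (height2 x u1) (height2 x u2)) as M2; fold m in M2.
assert (HX : forall u, in_T u Y -> X (A (pos u Y))).
{ intros u Hu; apply symmetry_A, X_pos, in_T_face, Hu. }
assert (Low : forall u, (u = u1 \/ u = u2) -> height2 x u = m ->
  m <= dX (pos x Y) (A (pos u Y)) ^ 2).
{ intros u Hu Hm; apply (vertex_distance x Y u1 u2); auto.
  - destruct Hu; subst u; lra.
  - destruct Hu; subst u; apply in_T_face; auto. }
assert (Up : forall q', X q' -> m <= dX (pos x Y) q' ^ 2 -> dX (pos x Y) q' ^ 2 <= m).
{ intros q' Hq' Hm.
  destruct (far_optimal x Y u1 u2 m H E1 E2 M1 M2 q' Hq' Hm) as [u [-> Hu]].
  assert (Tu : in_T u Y) by (destruct Hu as [[-> _] | [-> _]]; auto).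
  assert (Eu : height2 x u = m) by (destruct Hu as [[-> ?] | [-> ?]]; auto).
  destruct (bary_nonneg x Y (in_T_face x Y H)) as [P1 [P2 P3]].
  destruct (bary_nonneg u Y (in_T_face u Y Tu)) as [W1 [W2 W3]].
  (* On the line [T = Y] the height is the squared distance to image A, hence an upper bound. *)
  replace m with (imageA x Y u Y) by (rewrite imageA_eq; lra).
  rewrite <- planarA; apply pow_incr; split.
  - apply dX_nonneg; [apply X_pos, in_T_face, H | auto].
  - apply dX_le_unfold3_213; auto; apply bary_sum. }
assert (Hmax : height2 x u1 = m \/ height2 x u2 = m).
{ unfold m, Rmax; destruct Rle_dec; auto. }
split.
- intros [Hq Hmq].
  assert (Hm : m <= dX (pos x Y) q ^ 2).
  { assert (exists u, (u = u1 \/ u = u2) /\ height2 x u = m) as [u [Hu Hum]]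
      by (destruct Hmax; eauto).
    eapply Rle_trans; [apply (Low u Hu Hum) |].
    assert (HXu : X (A (pos u Y))) by (apply HX; destruct Hu; subst u; auto).
    apply pow_incr; split; [apply dX_nonneg; [apply X_pos, in_T_face, H | exact HXu] |].
    apply Hmq, HXu. }
  destruct (far_optimal x Y u1 u2 m H E1 E2 M1 M2 q Hq Hm) as [u [-> Hu]].
  destruct Hu as [[-> Hu] | [-> Hu]]; [left | right]; split; auto; lra.
- intro Hq.
  assert (exists u, q = A (pos u Y) /\ (u = u1 \/ u = u2) /\ height2 x u = m)
    as [u [-> [Hu Hum]]].
  { destruct Hq as [[-> Hle] | [-> Hle]]; eexists; split; eauto; split; auto;
      unfold m, Rmax; destruct Rle_dec; lra. }
  assert (HXu : X (A (pos u Y))) by (apply HX; destruct Hu; subst u; auto).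
  split; [exact HXu |]; intros q' Hq'.
  apply Rnot_lt_le; intro Hlt.
  pose proof (dX_nonneg _ _ (X_pos x Y (in_T_face x Y H)) HXu).
  specialize (Low u Hu Hum).
  specialize (Up q' Hq'); nra.
Qed.

(** * Comparison of the two vertices *)

Definition on_side (x Y : R) : Prop := (3 * x - Y) * (1 - x - Y) = 0.

(** Up to a positive factor this is [u1 + u2 + 2 * x - 1], the cofactor of [u1 - u2] in the
    difference of the heights. Solving [balance x Y = 0] for [Y] gives the cube root in [J_fun]. *)
Definition balance (x Y : R) : R :=
  (1 - x - Y) ^ 3 - (2 + x) * (5 - 2 * x) * (1 - 4 * x).

(** For [x] between 0 and 1 the product has derivative [24 * x ^ 2 - 12 * x - 39], at most -27,
    whereas the cube has derivative at least -3. The inequalities below certify this without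
    derivatives. *)
Lemma balance_monotone x x' Y : 0 <= x -> x <= x' -> x' + Y <= 1 -> 0 <= Y ->
  balance x Y <= balance x' Y.
Proof.
intros Hx Hxx' H1 HY; unfold balance.
set (a := 1 - x' - Y); set (d := x' - x).
replace (1 - x - Y) with (a + d) by (unfold a, d; ring).
replace x' with (x + d) by (unfold d; ring).
assert (Ha : 0 <= a) by (unfold a; lra); assert (Hd : 0 <= d) by (unfold d; lra).
assert (Had : a + d + x <= 1) by (unfold a, d; lra).
assert (0 <= a * d) by (apply Rmult_le_pos; lra).
assert (0 <= d * (1 - (3 * a ^ 2 + 3 * a * d + d ^ 2) / 3)) by (apply Rmult_le_pos; nra).
assert (0 <= d * (1 - x ^ 2)) by (apply Rmult_le_pos; nra).
assert (0 <= d * (x * (1 - x - d))) by (apply Rmult_le_pos; nra).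
assert (0 <= d * (d * (1 - x - d))) by (apply Rmult_le_pos; nra).
assert (0 <= d * (1 - d)) by (apply Rmult_le_pos; nra).
assert (0 <= d * (1 - x)) by (apply Rmult_le_pos; nra).
assert (0 <= d * x) by (apply Rmult_le_pos; nra).
nra.
Qed.

Lemma right_vertex_shift x Y : in_T x Y ->
  (right_vertex x Y - x) * (3 + 3 * x + Y) = (3 * x - Y) * (1 - x - Y).
Proof. intro H; rewrite Rmult_minus_distr_r, right_vertex_eq by auto; ring. Qed.

Lemma left_vertex_shift x Y : in_T x Y ->
  (x - left_vertex x Y) * (6 - 3 * x - Y) = (3 * x - Y) * (1 - x - Y).
Proof. intro H; rewrite Rmult_minus_distr_r, left_vertex_eq by auto; ring. Qed.

Lemma right_vertex_fixed x Y : in_T x Y -> right_vertex x Y = x <-> on_side x Y.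
Proof.
intro H; pose proof (right_vertex_shift x Y H) as E; unfold on_side; rewrite <- E; split.
- intros ->; ring.
- intro Z; apply Rmult_integral in Z; unfold in_T in H; lra.
Qed.

Lemma left_vertex_fixed x Y : in_T x Y -> left_vertex x Y = x <-> on_side x Y.
Proof.
intro H; pose proof (left_vertex_shift x Y H) as E; unfold on_side; rewrite <- E; split.
- intros ->; ring.
- intro Z; apply Rmult_integral in Z; unfold in_T in H; lra.
Qed.

Lemma vertices_equal x Y : in_T x Y -> right_vertex x Y = left_vertex x Y <-> on_side x Y.
Proof.
intro H; rewrite <- right_vertex_fixed by auto; split.
- pose proof (vertices_bounds x Y H); lra.
- intro E; rewrite E; symmetry; apply left_vertex_fixed, right_vertex_fixed; auto.
Qed.

Lemma height2_balance x Y : in_T x Y -> exists k, 0 < k /\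
  height2 x (right_vertex x Y) - height2 x (left_vertex x Y) =
  (right_vertex x Y - left_vertex x Y) * (k * balance x Y).
Proof.
intro H; exists (2 / ((3 + 3 * x + Y) * (6 - 3 * x - Y))); unfold in_T in H; split.
- apply Rdiv_lt_0_compat; [lra | apply Rmult_lt_0_compat; lra].
- unfold height2, right_vertex, left_vertex, balance; field; lra.
Qed.

(** Within [T] the first alternative adds only the apex, where [balance] vanishes but the two
    vertices coincide. *)
Definition regular (x Y : R) : Prop := on_side x Y \/ balance x Y <> 0.

(** Regularity persists because the move goes left where [balance] is negative and right where it is
    positive, and by monotonicity its sign is kept. This invariant makes all iterates defined. *)
Lemma farthest_regular x Y : in_T x Y -> regular x Y ->
  exists u, (forall q, farthest (pos x Y) q <-> q = A (pos u Y)) /\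
    in_T u Y /\ regular u Y /\ (u = x <-> on_side x Y).
Proof.
intros H HR.
destruct (height2_balance x Y H) as [k [Hk Eh]].
pose proof (vertices_bounds x Y H) as [B1 [B2 B3]].
destruct (in_T_vertices x Y H) as [T1 T2].
pose proof (vertices_equal x Y H) as EV.
destruct (Rtotal_order (balance x Y) 0) as [Hb | [Hb | Hb]].
- exists (left_vertex x Y); split; [| split; [exact T2 | split]].
  + assert (N : 0 <= (right_vertex x Y - left_vertex x Y) * (k * - balance x Y))
      by (repeat apply Rmult_le_pos; lra).
    intro q; rewrite (farthest_pos x Y q H); split; [| intros ->; right; split; [auto | lra]].
    intros [[-> Hle] | [-> _]]; [| reflexivity].
    assert (Z : (right_vertex x Y - left_vertex x Y) * (k * - balance x Y) = 0) by lra.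
    apply Rmult_integral in Z as [Z | Z]; [do 2 f_equal; lra |].
    apply Rmult_integral in Z; lra.
  + right; assert (balance (left_vertex x Y) Y <= balance x Y); [| lra].
    apply balance_monotone; unfold in_T in *; lra.
  + apply left_vertex_fixed, H.
- assert (S : on_side x Y) by (destruct HR; [auto | contradiction]).
  exists x; split; [| split; [exact H | split; [exact HR | tauto]]].
  intro q; rewrite (farthest_pos x Y q H).
  assert (Er : right_vertex x Y = x) by (apply right_vertex_fixed; auto).
  assert (El : left_vertex x Y = x) by (apply left_vertex_fixed; auto).
  rewrite Er, El; split; [intros [[-> _] | [-> _]]; auto | intros ->; left; split; [auto | lra]].
- exists (right_vertex x Y); split; [| split; [exact T1 | split]].
  + assert (N : 0 <= (right_vertex x Y - left_vertex x Y) * (k * balance x Y))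
      by (repeat apply Rmult_le_pos; lra).
    intro q; rewrite (farthest_pos x Y q H); split; [| intros ->; left; split; [auto | lra]].
    intros [[-> _] | [-> Hle]]; [reflexivity |].
    assert (Z : (right_vertex x Y - left_vertex x Y) * (k * balance x Y) = 0) by lra.
    apply Rmult_integral in Z as [Z | Z]; [do 2 f_equal; lra |].
    apply Rmult_integral in Z; lra.
  + right; assert (balance x Y <= balance (right_vertex x Y) Y); [| lra].
    apply balance_monotone; unfold in_T in *; lra.
  + apply right_vertex_fixed, H.
Qed.

Lemma pos_inj u T u' T' : pos u T = pos u' T' -> u = u' /\ T = T'.
Proof.
pose proof circumradius_pos as Hc; unfold pos, bary1, bary2, bary3; intro E.
injection E as E1 E2 E3.
apply Rmult_eq_reg_l in E1; [| lra]; apply Rmult_eq_reg_l in E2; [| lra]; lra.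
Qed.

Lemma A_involutive q : A (A q) = q.
Proof. apply symmetry_A. Qed.

Lemma A_inj q q' : A q = A q' -> q = q'.
Proof. intro E; rewrite <- (A_involutive q), E; apply A_involutive. Qed.

Lemma farthest_irregular x Y : in_T x Y -> ~ regular x Y -> ~ X' (pos x Y).
Proof.
intros H HR [_ [q [_ Hq]]].
assert (Hb : balance x Y = 0) by (apply NNPP; intro; apply HR; right; auto).
destruct (height2_balance x Y H) as [k [Hk Eh]]; rewrite Hb in Eh.
apply HR; left; apply (vertices_equal x Y H).
assert (E1 : q = A (pos (right_vertex x Y) Y)).
{ apply Hq, farthest_pos; auto; left; split; [auto | lra]. }
assert (E2 : q = A (pos (left_vertex x Y) Y)).
{ apply Hq, farthest_pos; auto; right; split; [auto | lra]. }
rewrite E1 in E2; apply A_inj in E2; apply pos_inj in E2; apply E2.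
Qed.

Lemma X'_regular x Y : in_T x Y -> X' (pos x Y) <-> regular x Y.
Proof.
intro H; split.
- intro HX; apply NNPP; intro N; exact (farthest_irregular x Y H N HX).
- intro HR; split; [apply X_pos, in_T_face, H |].
  destruct (farthest_regular x Y H HR) as [u [Hu _]].
  exists (A (pos u Y)); split; [apply Hu; reflexivity |].
  intros q Hq; symmetry; apply Hu, Hq.
Qed.

(** * The sets [T], [dT_infty] and [J] in coordinates *)

Lemma sqrt3_pos : 0 < sqrt 3.
Proof. apply sqrt_lt_R0; lra. Qed.

Lemma emb_pos x y : emb (x, y) = pos x (sqrt 3 * y).
Proof. reflexivity. Qed.

Lemma T_pos p : T p <-> exists x Y, in_T x Y /\ p = pos x Y.
Proof.
pose proof sqrt3_sqr as S; split.
- intros [w [[a [b [d [Ha [Hb [Hd [Hs ->]]]]]]] ->]]; rewrite emb_pos; simpl.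
  exists (b + d / 4), (3 * d / 4); split; [unfold in_T; lra |].
  f_equal; [field |].
  transitivity (d * (sqrt 3 * sqrt 3) / 4); [field | rewrite S; field].
- intros [x [Y [H ->]]]; unfold in_T in H.
  exists (x, sqrt 3 * (Y / 3)); split.
  + exists (1 - x - Y), (x - Y / 3), (4 * Y / 3); simpl.
    repeat split; try lra; f_equal; field.
  + rewrite emb_pos; f_equal.
    transitivity (sqrt 3 * sqrt 3 * Y / 3); [rewrite S; field | field].
Qed.

Lemma dT_infty_pos p : dT_infty p <-> exists x Y, in_T x Y /\ on_side x Y /\ p = pos x Y.
Proof.
pose proof sqrt3_sqr as S; split.
- intros [w [[[a [b [Ha [Hb [Hs ->]]]]] | [a [b [Ha [Hb [Hs ->]]]]]] ->]]; rewrite emb_pos; simpl.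
  + exists (b / 4), (3 * b / 4); split; [unfold in_T; lra | split; [unfold on_side; field |]].
    f_equal; [field |].
    transitivity (b * (sqrt 3 * sqrt 3) / 4); [field | rewrite S; field].
  + exists (a + b / 4), (3 * b / 4); split; [unfold in_T; lra | split].
    * unfold on_side; replace a with (1 - b) by lra; field.
    * f_equal; [field |].
      transitivity (b * (sqrt 3 * sqrt 3) / 4); [field | rewrite S; field].
- intros [x [Y [H [HS ->]]]]; unfold in_T in H; apply Rmult_integral in HS.
  exists (x, sqrt 3 * (Y / 3)); split.
  + destruct HS as [HS | HS]; [left; exists (1 - 4 * x), (4 * x) | right; exists (x - Y / 3), (4 * Y / 3)];
      simpl; repeat split; try lra; f_equal; try field; try lra.
    replace Y with (3 * x) by lra; field.
  + rewrite emb_pos; f_equal.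
    transitivity (sqrt 3 * sqrt 3 * Y / 3); [rewrite S; field | field].
Qed.

Lemma cube_root_cube b : 0 < b -> Rpower b (1 / 3) ^ 3 = b.
Proof.
intro Hb; rewrite <- Rpower_pow by apply exp_pos.
rewrite Rpower_mult; replace (1 / 3 * INR 3) with 1 by (simpl; field).
apply Rpower_1, Hb.
Qed.

Lemma cube_inj a b : 0 <= a -> 0 <= b -> a ^ 3 = b ^ 3 -> a = b.
Proof.
intros Ha Hb E.
assert (Z : (a - b) * (a ^ 2 + a * b + b ^ 2) = 0) by lra.
apply Rmult_integral in Z as [Z | Z]; [lra |].
assert (a = 0) by nra; assert (b = 0) by nra; lra.
Qed.

Lemma J_pos x Y : in_T x Y -> J (pos x Y) <-> ~ regular x Y.
Proof.
intro H; pose proof sqrt3_pos as S0.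
assert (EJ : forall x, sqrt 3 * J_fun x =
  1 - x - Rpower ((2 + x) * (5 - 2 * x) * (1 - 4 * x)) (1 / 3)).
{ intro z; unfold J_fun; field; lra. }
pose proof H as HT; destruct H as [HY [H3 H1]]; split.
- intros [[x' y] [[Hr Hy] E]]; simpl in Hr, Hy; rewrite emb_pos in E.
  apply pos_inj in E as [<- E]; rewrite Hy, EJ in E.
  set (b := (2 + x) * (5 - 2 * x) * (1 - 4 * x)) in *.
  assert (Hb : 0 < b) by (unfold b; repeat apply Rmult_lt_0_compat; lra).
  pose proof (cube_root_cube b Hb) as Ec.
  assert (Hc : 0 < Rpower b (1 / 3)) by apply exp_pos.
  replace (Rpower b (1 / 3)) with (1 - x - Y) in * by lra.
  intros [HS | HN]; [| apply HN; unfold balance; fold b; lra].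
  apply Rmult_integral in HS as [HS | HS]; [| lra].
  replace (1 - x - Y) with (1 - 4 * x) in Ec by lra.
  (* The second factor is [9 * (2 * x + 1) * (x - 1)], nonzero for [0 <= x < 1 / 4]. *)
  assert (Z : (1 - 4 * x) * ((1 - 4 * x) ^ 2 - (2 + x) * (5 - 2 * x)) = 0) by (unfold b in Ec; lra).
  apply Rmult_integral in Z; nra.
- intro HN.
  assert (HS : ~ on_side x Y) by (intro; apply HN; left; auto).
  assert (Hb : balance x Y = 0) by (apply NNPP; intro; apply HN; right; auto).
  assert (Hpos : 0 < 1 - x - Y).
  { destruct (Req_dec (1 - x - Y) 0) as [Z |]; [| lra].
    exfalso; apply HS; unfold on_side; rewrite Z; ring. }
  unfold balance in Hb.
  set (b := (2 + x) * (5 - 2 * x) * (1 - 4 * x)) in *.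
  assert (Hb0 : 0 < b) by (pose proof (pow_lt _ 3 Hpos); lra).
  assert (Hx : x < 1 / 4).
  { apply Rnot_le_lt; intro; apply (Rlt_not_le _ _ Hb0); unfold b.
    assert (0 <= (2 + x) * (5 - 2 * x)) by (apply Rmult_le_pos; lra); nra. }
  exists (x, J_fun x); split; [split; [split |] |]; auto.
  + simpl; unfold r; destruct r_exists as [s [Hs Es]]; simpl.
    apply Rnot_lt_le; intro Hlt.
    (* This cubic is [- balance x 0 / 9]: its root [r] is where the curve meets [Y = 0], and
       lowering [Y] to 0 can only increase [balance]. *)
    assert (K : x ^ 3 - x ^ 2 - 4 * x + 1 <= 0).
    { assert ((1 - x - Y) ^ 3 <= (1 - x) ^ 3) by (apply pow_incr; lra).
      unfold b in Hb; lra. }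
    assert (0 < (s - x) * (4 + s + x - s ^ 2 - s * x - x ^ 2)) by (apply Rmult_lt_0_compat; nra).
    lra.
  + rewrite emb_pos, EJ; fold b; f_equal.
    assert (1 - x - Y = Rpower b (1 / 3)); [| lra].
    apply cube_inj; [lra | left; apply exp_pos | rewrite cube_root_cube; lra].
Qed.

(** * Dynamics *)

Lemma farthest_A p q : X p -> farthest p q -> farthest (A p) (A q).
Proof.
intros Hp [Hq Hmax]; split; [apply symmetry_A, Hq |].
intros q' Hq'; rewrite (dX_symmetry A) by auto using symmetry_A.
rewrite <- (A_involutive q'), (dX_symmetry A); auto using symmetry_A.
- apply Hmax, symmetry_A, Hq'.
- apply symmetry_A, Hq'.
Qed.

Lemma F_farthest p : X' p -> farthest p (F p).
Proof.
intros [_ [q [Hq _]]]; unfold F; apply epsilon_spec; exists q; exact Hq.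
Qed.

Lemma F_unique p q : X' p -> farthest p q -> F p = q.
Proof.
intros HX Hq; pose proof (F_farthest p HX) as HF.
destruct HX as [_ [q' [_ Hu]]]; rewrite <- (Hu _ Hq), <- (Hu _ HF); reflexivity.
Qed.

Lemma X'_A p : X' p -> X' (A p).
Proof.
intros [Hp [q [Hq Hu]]]; split; [apply symmetry_A, Hp |].
exists (A q); split; [apply farthest_A; auto |].
intros q' Hq'; apply A_inj; rewrite A_involutive; apply Hu.
rewrite <- (A_involutive p); apply farthest_A; [apply symmetry_A, Hp | exact Hq'].
Qed.

Lemma F_A p : X' p -> F (A p) = A (F p).
Proof.
intro HX; apply F_unique; [apply X'_A, HX |].
apply farthest_A; [apply HX | apply F_farthest, HX].
Qed.

Lemma X_infty_F p : X_infty p -> X_infty (F p).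
Proof. intros H n; apply (H (S n)). Qed.

(** [F] sends regular points of [T] to the antipodal face; this invariance lets the induction on
    iterates continue in [T]. *)
Lemma X_iter_A n p : X_iter n p -> X_iter n (A p).
Proof.
revert p; induction n as [| n IH]; intros p H; [apply X'_A, H |].
destruct H as [HX H]; split; [apply X'_A, HX | rewrite F_A by exact HX; apply IH, H].
Qed.

Lemma X_infty_f p : X_infty p -> X_infty (f p).
Proof. intro H; apply X_infty_F; intro n; apply X_iter_A, H. Qed.

Lemma F_regular x Y : in_T x Y -> regular x Y -> exists u,
  F (pos x Y) = A (pos u Y) /\ in_T u Y /\ regular u Y /\ (u = x <-> on_side x Y).
Proof.
intros H HR; destruct (farthest_regular x Y H HR) as [u [Hu K]].
exists u; split; [| exact K].
apply F_unique; [apply X'_regular; auto | apply Hu; reflexivity].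
Qed.

Lemma X_infty_regular x Y : in_T x Y -> regular x Y -> X_infty (pos x Y).
Proof.
intros H HR n; revert x Y H HR; induction n as [| n IH]; intros x Y H HR.
- apply X'_regular; auto.
- destruct (F_regular x Y H HR) as [u [E [Hu [Ru _]]]]; split.
  + apply X'_regular; auto.
  + rewrite E; apply X_iter_A, IH; auto.
Qed.

Lemma f_fixed x Y : in_T x Y -> regular x Y -> f (pos x Y) = pos x Y <-> on_side x Y.
Proof.
intros H HR; destruct (F_regular x Y H HR) as [u [E [_ [_ Hu]]]].
unfold f; rewrite F_A, E, A_involutive by (apply X'_regular; auto).
rewrite <- Hu; split; [intro K; apply (pos_inj _ _ _ _ K) | intros ->; reflexivity].
Qed.

(** This also covers limits on [J], where there are two farthest points: whichever vertex equals
    [x], the point lies on a side. *)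
Lemma farthest_antipode x Y : in_T x Y -> farthest (pos x Y) (A (pos x Y)) -> on_side x Y.
Proof.
intros H Hf; apply farthest_pos in Hf as [[E _] | [E _]]; [| | exact H];
  apply A_inj, pos_inj in E as [E _].
- apply right_vertex_fixed; auto.
- apply left_vertex_fixed; auto.
Qed.

(* The farthest-point relation is closed, so a limit of an orbit of [f] is
   a farthest point of its own antipode. *)
Lemma limit_farthest p : L_infty p -> farthest p (A p).
Proof.
intros [Hp [q [Hq Hlim]]].
assert (Ho : forall n, X_infty (Nat.iter n f q)).
{ induction n as [| n IH]; [exact Hq | apply X_infty_f, IH]. }
split; [apply symmetry_A, Hp |]; intros q' Hq'.
apply Rnot_lt_le; intro Hlt.
destruct (same_face_near p) as [d [Hd Hnear]].
(* The chain of triangle inequalities below has three errors less than [e], whence the third of the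
   gap. Staying below [d] puts the orbit in faces containing [p], where closeness in space bounds
   [dX]. *)
set (e := Rmin d ((dX p q' - dX p (A p)) / 3)).
assert (He : 0 < e / 3).
{ assert (0 < e) by (apply Rmin_glb_lt; lra); lra. }
destruct (Hlim (ball p (mkposreal _ He)) (locally_ball _ _)) as [N HN].
assert (Hclose : forall n, (N <= n)%nat -> dX p (Nat.iter n f q) < e).
{ intros n Hn; specialize (HN n Hn); apply dist3_ball in HN; simpl in HN.
  assert (e <= d) by apply Rmin_l.
  eapply Rle_lt_trans; [apply dX_same_face |]; [exact Hp | apply (Ho n O) | apply Hnear; lra | lra]. }
set (a := Nat.iter N f q) in *.
pose proof (Hclose N (le_n N)) as C1; fold a in C1.
pose proof (Hclose (S N) (le_S _ _ (le_n N))) as C2; simpl in C2; fold a in C2.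
pose proof (Ho N O : X' a) as Xa.
destruct (F_farthest _ (X'_A a Xa)) as [Xf Hf]; fold (f a) in Xf, Hf.
pose proof (proj1 Xa) as Xa0.
assert (XA : forall z, X z -> X (A z)) by apply symmetry_A.
pose proof (Hf (A q') (XA _ Hq')) as Hfar.
rewrite (dX_symmetry A) in Hfar by auto using symmetry_A.
pose proof (dX_triangle p a q' Hp Xa0 Hq').
pose proof (dX_triangle (A a) (A p) (f a) (XA _ Xa0) (XA _ Hp) Xf).
pose proof (dX_triangle (A p) p (f a) (XA _ Hp) Hp Xf).
rewrite (dX_symmetry A a p), (dX_sym a p) in * by auto using symmetry_A.
rewrite (dX_sym (A p) p) in * by auto.
assert (e <= (dX p q' - dX p (A p)) / 3) by apply Rmin_r.
lra.
Qed.

Theorem corollary1p2 :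
  ((forall p, X' p /\ T p <-> T p /\ ~ J p) /\
   (forall p, X_infty p /\ T p <-> T p /\ ~ J p)) /\
  (forall p, T p /\ ~ J p -> (f p = p <-> dT_infty p)) /\
  (forall p, L_infty p /\ T p <-> dT_infty p).
Proof.
assert (HJ : forall x Y, in_T x Y -> ~ J (pos x Y) <-> regular x Y).
{ intros x Y H; rewrite (J_pos x Y H); split; [apply NNPP | tauto]. }
assert (HdT : forall x Y, in_T x Y -> dT_infty (pos x Y) <-> on_side x Y).
{ intros x Y H; rewrite dT_infty_pos; split; [| eauto].
  intros [x' [Y' [_ [HS E]]]]; apply pos_inj in E as [-> ->]; exact HS. }
split; [split | split]; intro p.
- rewrite T_pos; split.
  + intros [HX [x [Y [H ->]]]]; split; [eauto |].
    apply HJ, X'_regular; auto.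
  + intros [[x [Y [H ->]]] HN]; split; [| eauto].
    apply X'_regular, HJ; auto.
- rewrite T_pos; split.
  + intros [HX [x [Y [H ->]]]]; split; [eauto |].
    apply HJ, X'_regular; auto; apply (HX O).
  + intros [[x [Y [H ->]]] HN]; split; [| eauto].
    apply X_infty_regular, HJ; auto.
- rewrite T_pos; intros [[x [Y [H ->]]] HN].
  rewrite HdT by auto; apply f_fixed, HJ; auto.
- rewrite T_pos; split.
  + intros [HL [x [Y [H ->]]]]; apply HdT, farthest_antipode; auto.
    apply limit_farthest, HL.
  + intro Hd; apply dT_infty_pos in Hd as [x [Y [H [HS ->]]]]; split; [| eauto].
    assert (HR : regular x Y) by (left; exact HS).
    split; [apply X_pos, in_T_face, H |].
    exists (pos x Y); split; [apply X_infty_regular; auto |].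
    assert (E : forall n, Nat.iter n f (pos x Y) = pos x Y).
    { induction n as [| n IH]; [reflexivity | simpl; rewrite IH; apply f_fixed; auto]. }
    apply filterlim_ext with (fun _ => pos x Y); [intro n; symmetry; apply E |].
    apply filterlim_const.
Qed.
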